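(* For all real $x>0$ and all $k,m\in\mathbb{N}$, the double inequalities $$k!\sum_{i=1}^{m}\frac1{(x+i-1)^{k+1}}+\frac{(k-1)!}{\Bigl\{x+m-1+\Bigl[\frac{(k-1)!}{\vert\psi^{(k)}(1)\vert}\Bigr]^{1/k}\Bigr\}^k}<\bigl\vert\psi^{(k)}(x)\bigr\vert<k!\sum_{i=1}^{m}\frac1{(x+i-1)^{k+1}}+\frac{(k-1)!}{\bigl(x+m-\frac12\bigr)^k}$$ and $$\frac{(k-1)!}{\Bigl\{x+\Bigl[\frac{(k-1)!}{\vert\psi^{(k)}(1)\vert}\Bigr]^{1/k}\Bigr\}^k}-k!\sum_{i=1}^{m-1}\frac1{(x+i)^{k+1}}<\bigl\vert\psi^{(k)}(x+m)\bigr\vert<\frac{(k-1)!}{\bigl(x+\frac12\bigr)^k}-k!\sum_{i=1}^{m-1}\frac1{(x+i)^{k+1}}$$ hold. Moreover, the quantities $\Bigl[\frac{(k-1)!}{\vert\psi^{(k)}(1)\vert}\Bigr]^{1/k}$ (in the lower bounds) and $\frac12$ (in the upper bounds, where $x+m-\frac12$ is read as $x+m-1+\frac12$) are the best possible in both double inequalities.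
   Context: $\mathbb{N}=\{1,2,3,\dots\}$; an empty sum is $0$. For $x>0$, $\Gamma(x)=\int_0^\infty t^{x-1}e^{-t}\,dt$ is the Euler gamma function, $\psi(x)=\Gamma'(x)/\Gamma(x)$ is the psi (digamma) function, and $\psi^{(k)}$ denotes the $k$-th derivative of $\psi$ (the polygamma functions, $k\in\mathbb{N}$). The $1/k$-th power is the positive real $k$-th root. ''Best possible'' means, for each fixed $k\in\mathbb{N}$, that in each of the two double inequalities, required to hold for all $x>0$ and all $m\in\mathbb{N}$, the quantity $\bigl[\frac{(k-1)!}{\vert\psi^{(k)}(1)\vert}\bigr]^{1/k}$ in the lower bound cannot be replaced by any smaller real number $\alpha\ge0$ (independent of $x$ and $m$), and the quantity $\frac12$ in the upper bound (i.e. the $\beta=\frac12$ in $(x+m-1+\beta)^k$ for the first double inequality, and in $(x+\beta)^k$ for the second) cannot be replaced by any larger real number $\beta$ (independent of $x$ and $m$). *)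

(* Defs.v *)
(* Stdlib reals with Coquelicot *)
From Stdlib Require Import Reals Factorial.
From Coquelicot Require Import Coquelicot.
Open Scope R_scope.

(** The functions below are used at positive arguments only. *)

Definition Gamma (x : R) : R :=
  RInt_gen (fun t : R => Rpower t (x - 1) * exp (- t))
    (at_right 0) (Rbar_locally p_infty).

Definition psi (x : R) : R := Derive Gamma x / Gamma x.

Definition polygamma (k : nat) (x : R) : R := Derive_n psi k x.

(** The positive [k]-th root of [(k-1)! / |psi^(k)(1)|], for [1 <= k]. *)
Definition lower_shift (k : nat) : R :=
  Rpower (INR (fact (k - 1)) / Rabs (polygamma k 1)) (/ INR k).

(** [sum_n_m a 1 m] is [a 1 + ... + a m], and it is [0] when [m = 0]. *)
Definition head_sum (k m : nat) (x : R) : R :=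
  sum_n_m (fun i : nat => / (x + INR i - 1) ^ (k + 1)) 1 m.

Definition shifted_sum (k m : nat) (x : R) : R :=
  sum_n_m (fun i : nat => / (x + INR i) ^ (k + 1)) 1 (m - 1).

(* Main.v *)
(** The functional equation and [Gamma (a + s) <= a^s Gamma a] for [0 <= s <= 1]
    give Euler's limit for [ln Gamma], and differentiating it shows
    [|psi^(k)(x)| = k! Z(x)] with [Z(x)] the sum of the [1/(x+n)^(k+1)], [n >= 0].
    Splitting off finitely many terms reduces all the claims to
    [(y+alpha)^-k < k Z(y+1) < (y+1/2)^-k], [alpha] being defined by
    [k Z(1) = alpha^-k].  The upper bound telescopes, by the midpoint inequality
    for [t^(-k-1)], and the trapezoidal inequality shows that 1/2 is optimal.
    For the lower bound,
      [(k-1)! (k Z(y+1) - (y+alpha)^-k)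
         = int_0^oo t^(k-1) (t/(e^t-1) - e^(-alpha t)) e^(-y t) dt],
    where the bracket changes sign exactly once, from + to -.  The integral
    vanishes at [y = 0], hence is positive for [y > 0] since [e^(-y t)]
    decreases in [t].  Optimality of [alpha] follows by taking
    [y = alpha - alpha'] for a smaller [alpha']. *)

Require Import Defs.
From Stdlib Require Import Reals Factorial Lra Lia.
From Coquelicot Require Import Coquelicot.
Open Scope R_scope.

(** The integral behind the lower bound is never formed. Truncating [1 / (exp t - 1)] to a geometric
    sum turns the integrand into a finite combination of functions [t^j exp (- a t)], whose
    primitives are explicit; positivity of the integral becomes monotonicity of a primitive, and the
    exchange of sum and integral becomes a limit in the number of terms. Strictness has to survive
    the limits in [t] and in that number, so a positive gap independent of both is carried along.
    The single sign change rests on [1/2 < alpha < 1]: the left inequality is the upper bound itself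
    at [y = 0], the right one says that [k Z(1)] exceeds 1. Differentiation of limits, for
    [ln Gamma] as for the series, rests on a bound on second derivatives that is uniform in the
    index. The midpoint and trapezoidal inequalities are proved as polynomial inequalities between
    reciprocals. *)

(** * Midpoint and trapezoidal inequalities for powers *)

Lemma pow_diff_S (u v : R) (k : nat) :
  u ^ S k - v ^ S k
  = ((u + v) * (u ^ k - v ^ k) + (u - v) * (u ^ k + v ^ k)) / 2.
Proof. simpl; field. Qed.

Lemma pow_sum_S (u v : R) (k : nat) :
  u ^ S k + v ^ S k
  = ((u + v) * (u ^ k + v ^ k) + (u - v) * (u ^ k - v ^ k)) / 2.
Proof. simpl; field. Qed.

(** Convexity of the power, by induction: in [pow_sum_S] the cross term [(u - v) * (u ^ k - v ^ k)]
    is nonnegative. The symmetric recurrences let the inductions use only bounds on [u + v] and on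
    [u - v]. *)
Lemma pow_sum_mean_le (u v w : R) (k : nat) :
  0 < w -> 0 < v <= u -> 2 * w <= u + v -> 2 * w ^ k <= u ^ k + v ^ k.
Proof.
intros Hw Hv Hm; induction k as [|k IH]; [simpl; lra|].
rewrite pow_sum_S.
assert (H1 : v ^ k <= u ^ k) by (apply pow_incr; lra).
assert (H2 : 0 < w ^ k) by (apply pow_lt; lra).
assert (H3 : 2 * w * (2 * w ^ k) <= (u + v) * (u ^ k + v ^ k))
  by (apply Rmult_le_compat; lra).
assert (H4 : 0 <= (u - v) * (u ^ k - v ^ k)) by (apply Rmult_le_pos; lra).
simpl; lra.
Qed.

(** Meant for [w = 1/t], [u = 1/(t - 1/2)], [v = 1/(t + 1/2)]: the midpoint rule for the integral of
    [(k + 1) s^(-k-2)] over the unit interval centred at [t]. *)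
Lemma pow_diff_gt_mid (u v w : R) (k : nat) :
  0 < w -> 0 < v <= u -> 2 * w <= u + v -> w ^ 2 < u - v ->
  INR (S k) * w ^ S (S k) < u ^ S k - v ^ S k.
Proof.
intros Hw Hv Hm Hd; induction k as [|k IH]; [simpl in *; lra|].
rewrite pow_diff_S, S_INR.
assert (H1 : 0 < w ^ S k) by (apply pow_lt; lra).
assert (H2 := pow_sum_mean_le u v w (S k) Hw Hv Hm).
assert (H3 : 0 < w ^ S (S k)) by (apply pow_lt; lra).
assert (H4 := pos_INR (S k)).
assert (H5 : 2 * w * (INR (S k) * w ^ S (S k))
             <= (u + v) * (u ^ S k - v ^ S k)).
{ apply Rmult_le_compat; [lra| |lra|lra]. apply Rmult_le_pos; lra. }
assert (H6 : w ^ 2 * (2 * w ^ S k) < (u - v) * (u ^ S k + v ^ S k)).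
{ apply Rlt_le_trans with ((u - v) * (2 * w ^ S k)).
  - apply Rmult_lt_compat_r; lra.
  - apply Rmult_le_compat_l; [|exact H2]. assert (0 <= w ^ 2) by apply pow2_ge_0. lra. }
replace (w ^ S (S (S k))) with (w * w ^ S (S k)) by (simpl; ring).
replace (w ^ 2 * (2 * w ^ S k)) with (2 * (w * w ^ S (S k))) in H6 by (simpl; ring).
lra.
Qed.

(** Meant for [u = 1/t] and [v = 1/(t + 1)], for which [u - v = u * v]. The induction step needs two
    rearrangement inequalities, [H6] and [H7], both consequences of [H3]. *)
Lemma pow_diff_le_trapezoid (u v : R) (k : nat) :
  0 < v <= u -> u - v = u * v ->
  u ^ k - v ^ k <= INR k / 2 * (u ^ S k + v ^ S k).
Proof.
intros Hv Hd; induction k as [|k IH]; [simpl; lra|].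
rewrite pow_diff_S, S_INR, Hd.
assert (H1 : v ^ k <= u ^ k) by (apply pow_incr; lra).
assert (H2 : v ^ S k <= u ^ S k) by (apply pow_incr; lra).
assert (H3 : 0 <= (u - v) * (u ^ S k - v ^ S k)) by (apply Rmult_le_pos; lra).
assert (H4 := pos_INR k).
assert (H5 : (u + v) * (u ^ k - v ^ k)
             <= (u + v) * (INR k / 2 * (u ^ S k + v ^ S k)))
  by (apply Rmult_le_compat_l; lra).
assert (H6 : (u + v) * (u ^ S k + v ^ S k) <= 2 * (u ^ S (S k) + v ^ S (S k))).
{ replace (u ^ S (S k)) with (u * u ^ S k) by (simpl; ring).
  replace (v ^ S (S k)) with (v * v ^ S k) by (simpl; ring). lra. }
assert (H7 : u * v * (u ^ k + v ^ k) <= u ^ S (S k) + v ^ S (S k)).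
{ replace (u ^ S (S k)) with (u * u ^ S k) by (simpl; ring).
  replace (v ^ S (S k)) with (v * v ^ S k) by (simpl; ring).
  replace (u * v * (u ^ k + v ^ k)) with (v * u ^ S k + u * v ^ S k)
    by (simpl; ring). lra. }
assert (H8 : INR k / 2 * ((u + v) * (u ^ S k + v ^ S k))
             <= INR k / 2 * (2 * (u ^ S (S k) + v ^ S (S k))))
  by (apply Rmult_le_compat_l; lra).
lra.
Qed.

Lemma sum_Sn_R (u : nat -> R) (n : nat) : sum_n u (S n) = sum_n u n + u (S n).
Proof. exact (sum_Sn u n). Qed.

(** * Hurwitz zeta sums *)

Definition hurwitz_term (p : nat) (x : R) (n : nat) : R := / (x + INR n) ^ p.

(** [Series] is total; the lemmas below write the exponent as [S (S p)], so that it is at least 2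
    and the sum converges. *)
Definition hurwitz (p : nat) (x : R) : R := Series (hurwitz_term p x).

Lemma hurwitz_term_pos (p : nat) (x : R) (n : nat) :
  0 < x -> 0 < hurwitz_term p x n.
Proof.
intros Hx; apply Rinv_0_lt_compat, pow_lt.
assert (H := pos_INR n); lra.
Qed.

Lemma hurwitz_term_decr (p : nat) (x y : R) (n : nat) :
  0 < x <= y -> hurwitz_term p y n <= hurwitz_term p x n.
Proof.
intros Hxy; assert (H := pos_INR n).
apply Rinv_le_contravar; [apply pow_lt|apply pow_incr]; lra.
Qed.

Definition hurwitz_bound (p : nat) (x : R) : R := (/ x) ^ p * ((1 + / x) * / x).

(* [1/t^2 <= (1 + 1/x) (1/t - 1/(t+1))] for [t >= x], and the right side telescopes. *)
Lemma hurwitz_partial_bound (p : nat) (x : R) (N : nat) :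
  0 < x -> sum_n (hurwitz_term (S (S p)) x) N <= hurwitz_bound p x.
Proof.
intros Hx.
assert (Hix : 0 < / x) by (apply Rinv_0_lt_compat; lra).
assert (Hp : 0 < (/ x) ^ p) by (apply pow_lt; lra).
assert (Hterm : forall n, hurwitz_term (S (S p)) x n <=
  (/ x) ^ p * ((1 + / x) * (/ (x + INR n) - / (x + INR (S n))))).
{ intros n; assert (Hn := pos_INR n); unfold hurwitz_term.
  rewrite S_INR; set (t := x + INR n).
  assert (Ht : x <= t) by (unfold t; lra).
  replace (x + (INR n + 1)) with (t + 1) by (unfold t; ring).
  replace (/ t ^ S (S p)) with ((/ t) ^ p * (/ t * / t)).
  2: { rewrite <- !pow_inv; simpl; ring. }
  assert (Hit : 0 < / t) by (apply Rinv_0_lt_compat; lra).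
  apply Rmult_le_compat.
  - apply pow_le; lra.
  - nra.
  - apply pow_incr; split; [lra|]. apply Rinv_le_contravar; lra.
  - replace (/ t - / (t + 1)) with (/ t * / (t + 1)) by (field; lra).
    replace ((1 + / x) * (/ t * / (t + 1))) with (/ t * ((1 + / x) * / (t + 1)))
      by ring.
    apply Rmult_le_compat_l; [lra|].
    apply Rmult_le_reg_r with (t + 1); [lra|].
    rewrite Rmult_assoc, Rinv_l by lra.
    assert (Hle : / t <= / x) by (apply Rinv_le_contravar; lra).
    rewrite Rmult_plus_distr_l, Rinv_l by lra; lra. }
assert (Htel : forall M, sum_n (hurwitz_term (S (S p)) x) M <=
  (/ x) ^ p * ((1 + / x) * (/ x - / (x + INR (S M))))).
{ intros M; induction M as [|M IH].
  - rewrite sum_O. eapply Rle_trans; [apply Hterm|]. change (INR 0) with 0; rewrite Rplus_0_r; lra.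
  - rewrite sum_Sn_R.
    eapply Rle_trans; [apply Rplus_le_compat; [exact IH|apply Hterm]|].
    rewrite <- Rmult_plus_distr_l; apply Rmult_le_compat_l; [lra|].
    rewrite <- Rmult_plus_distr_l; apply Rmult_le_compat_l; lra. }
eapply Rle_trans; [apply Htel|].
apply Rmult_le_compat_l; [lra|]. apply Rmult_le_compat_l; [lra|].
assert (H := pos_INR (S N)).
assert (0 < / (x + INR (S N))) by (apply Rinv_0_lt_compat; lra). lra.
Qed.

Lemma hurwitz_partial_incr (p : nat) (x : R) (N : nat) :
  0 < x -> sum_n (hurwitz_term p x) N <= sum_n (hurwitz_term p x) (S N).
Proof.
intros Hx; rewrite sum_Sn_R.
assert (H := hurwitz_term_pos p x (S N) Hx); lra.
Qed.

Lemma hurwitz_ex_series (p : nat) (x : R) :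
  0 < x -> ex_series (hurwitz_term (S (S p)) x).
Proof.
intros Hx.
destruct (ex_finite_lim_seq_incr (sum_n (hurwitz_term (S (S p)) x))
  (hurwitz_bound p x)) as [l Hl].
- intros n; apply hurwitz_partial_incr, Hx.
- intros n; apply hurwitz_partial_bound, Hx.
- exists l; exact Hl.
Qed.

Lemma hurwitz_lim (p : nat) (x : R) :
  0 < x ->
  is_lim_seq (sum_n (hurwitz_term (S (S p)) x)) (hurwitz (S (S p)) x).
Proof. intros Hx; apply Series_correct, hurwitz_ex_series, Hx. Qed.

Lemma hurwitz_term_shift (p : nat) (x : R) (n : nat) :
  hurwitz_term p x (S n) = hurwitz_term p (x + 1) n.
Proof. unfold hurwitz_term; rewrite S_INR; do 2 f_equal; ring. Qed.

Lemma hurwitz_rec (p : nat) (x : R) :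
  0 < x -> hurwitz (S (S p)) x = / x ^ S (S p) + hurwitz (S (S p)) (x + 1).
Proof.
intros Hx; unfold hurwitz.
rewrite Series_incr_1 by (apply hurwitz_ex_series; lra).
f_equal.
- unfold hurwitz_term; simpl INR; now rewrite Rplus_0_r.
- apply Series_ext; intros n; apply hurwitz_term_shift.
Qed.

Lemma hurwitz_decr (p : nat) (x y : R) :
  0 < x <= y -> hurwitz (S (S p)) y <= hurwitz (S (S p)) x.
Proof.
intros Hxy; apply Series_le; [|apply hurwitz_ex_series; lra].
intros n; split; [apply Rlt_le, hurwitz_term_pos; lra|].
apply hurwitz_term_decr; lra.
Qed.

Lemma hurwitz_pos (p : nat) (x : R) : 0 < x -> 0 < hurwitz (S (S p)) x.
Proof.
intros Hx; apply Rlt_le_trans with (sum_n (hurwitz_term (S (S p)) x) 0).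
- rewrite sum_O; now apply hurwitz_term_pos.
- apply (is_lim_seq_incr_compare _ _ (hurwitz_lim p x Hx)).
  intros n; now apply hurwitz_partial_incr.
Qed.

Lemma sum_n_le_lim (u v : nat -> R) (l c : R) :
  (forall n, sum_n u n <= c - v n) -> is_lim_seq (sum_n u) l ->
  is_lim_seq v 0 -> l <= c.
Proof.
intros H Hu Hv.
assert (H1 : is_lim_seq (fun n => c - v n) (c - 0)).
{ apply (is_lim_seq_minus' (fun _ => c)); [apply is_lim_seq_const|exact Hv]. }
assert (H2 := is_lim_seq_le _ _ _ _ H Hu H1); simpl in H2; lra.
Qed.

Lemma inv_pow_shift_lim (x : R) (k : nat) :
  0 < x -> is_lim_seq (fun n => / (x + INR n) ^ S k) 0.
Proof.
intros Hx.
apply is_lim_seq_ext with (fun n => (/ (x + INR n)) ^ S k).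
{ intros n; apply pow_inv. }
assert (H1 : is_lim_seq (fun n => / (x + INR n)) 0).
{ replace (Finite 0) with (Rbar_inv p_infty) by reflexivity.
  apply is_lim_seq_inv; [|discriminate].
  apply is_lim_seq_plus with x p_infty; [apply is_lim_seq_const|apply is_lim_seq_INR|reflexivity]. }
induction k as [|k IH].
- apply is_lim_seq_ext with (2 := H1); intros n; simpl; ring.
- apply is_lim_seq_ext with (fun n => / (x + INR n) * (/ (x + INR n)) ^ S k).
  { intros n; reflexivity. }
  replace 0 with (0 * 0) by ring; now apply is_lim_seq_mult'.
Qed.

Lemma hurwitz_midpoint (k : nat) (t : R) :
  / 2 < t ->
  INR (S k) * / t ^ S (S k) < / (t - / 2) ^ S k - / (t + / 2) ^ S k.
Proof.
intros Ht; rewrite <- !pow_inv.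
assert (Ha : 0 < / (t - / 2)) by (apply Rinv_0_lt_compat; lra).
assert (Hb : 0 < / (t + / 2)) by (apply Rinv_0_lt_compat; lra).
assert (Hc : 0 < / t) by (apply Rinv_0_lt_compat; lra).
assert (Hab : 0 < / ((t - / 2) * (t + / 2))) by (apply Rinv_0_lt_compat; nra).
apply pow_diff_gt_mid.
- exact Hc.
- split; [exact Hb|]. apply Rinv_le_contravar; lra.
- assert (/ (t - / 2) + / (t + / 2) - 2 * / t
    = / t * (/ 2 * / ((t - / 2) * (t + / 2)))) by (field; lra).
  nra.
- assert (/ (t - / 2) - / (t + / 2) - (/ t) ^ 2
    = / 4 * ((/ t * / t) * / ((t - / 2) * (t + / 2)))) by (field; lra).
  assert (0 < / t * / t * / ((t - / 2) * (t + / 2)))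
    by (apply Rmult_lt_0_compat; [nra|assumption]). lra.
Qed.

Lemma hurwitz_lt_midpoint (k : nat) (x : R) :
  / 2 < x -> INR (S k) * hurwitz (S (S k)) x < / (x - / 2) ^ S k.
Proof.
revert x; assert (Hle : forall x, / 2 < x ->
  INR (S k) * hurwitz (S (S k)) x <= / (x - / 2) ^ S k).
{ intros x Hx.
  apply sum_n_le_lim with
    (u := fun n => INR (S k) * hurwitz_term (S (S k)) x n)
    (v := fun n => / (x + / 2 + INR n) ^ S k).
  - intros N; induction N as [|N IH].
    + rewrite sum_O. unfold hurwitz_term; simpl INR; rewrite !Rplus_0_r.
      now apply Rlt_le, hurwitz_midpoint.
    + rewrite sum_Sn_R.
      assert (HN := pos_INR (S N)).
      assert (Hm := hurwitz_midpoint k (x + INR (S N))).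
      unfold hurwitz_term at 2.
      replace (x + INR (S N) + / 2) with (x + / 2 + INR (S N)) in Hm by ring.
      replace (x + INR (S N) - / 2) with (x + / 2 + INR N) in Hm
        by (rewrite S_INR; lra).
      specialize (Hm ltac:(lra)). lra.
  - apply is_lim_seq_ext with
      (fun n => INR (S k) * sum_n (hurwitz_term (S (S k)) x) n).
    { intros n; symmetry; apply (sum_n_scal_l (INR (S k)) (hurwitz_term (S (S k)) x)). }
    apply (is_lim_seq_mult' (fun _ => INR (S k))); [apply is_lim_seq_const|].
    apply hurwitz_lim; lra.
  - apply inv_pow_shift_lim; lra. }
(* The limit only keeps the weak inequality; strictness is recovered by splitting off the first
   term, where the midpoint inequality is strict. *)
intros x Hx; rewrite hurwitz_rec by lra.
assert (H1 := hurwitz_midpoint k x Hx).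
assert (H2 := Hle (x + 1) ltac:(lra)).
replace (x + 1 - / 2) with (x + / 2) in H2 by lra. lra.
Qed.

(** Adding the trapezoidal steps counts the first and the last term by half. The missing half of the
    first one is the second summand of the bound; what remains at the far end tends to 0. *)
Lemma hurwitz_ge_trapezoid (k : nat) (x : R) :
  0 < x ->
  / x ^ S k + INR (S k) / 2 * / x ^ S (S k)
  <= INR (S k) * hurwitz (S (S k)) x.
Proof.
intros Hx.
assert (Hstep : forall t, 0 < t -> / t ^ S k - / (t + 1) ^ S k
  <= INR (S k) / 2 * (/ t ^ S (S k) + / (t + 1) ^ S (S k))).
{ intros t Ht; rewrite <- !pow_inv; apply pow_diff_le_trapezoid; [|field; lra].
  split; [apply Rinv_0_lt_compat; lra|apply Rinv_le_contravar; lra]. }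
assert (Hl : is_lim_seq (fun n => - (INR (S k) * sum_n (hurwitz_term (S (S k)) x) n))
  (- (INR (S k) * hurwitz (S (S k)) x))).
{ apply (proj1 (is_lim_seq_opp _ (Finite _))).
  apply (is_lim_seq_mult' (fun _ => INR (S k))); [apply is_lim_seq_const|].
  apply hurwitz_lim; lra. }
assert (Hv : is_lim_seq (fun n => - / (x + INR n) ^ S k
    + INR (S k) / 2 * / (x + INR n) ^ S (S k)) 0).
{ replace 0 with (- 0 + INR (S k) / 2 * 0) by ring.
  apply is_lim_seq_plus'.
  - apply (proj1 (is_lim_seq_opp _ (Finite _))). now apply inv_pow_shift_lim.
  - apply (is_lim_seq_mult' (fun _ => INR (S k) / 2)); [apply is_lim_seq_const|]. now apply inv_pow_shift_lim. }
assert (Hle : forall n, - (INR (S k) * sum_n (hurwitz_term (S (S k)) x) n)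
  <= - (/ x ^ S k + INR (S k) / 2 * / x ^ S (S k))
     - (- / (x + INR n) ^ S k + INR (S k) / 2 * / (x + INR n) ^ S (S k))).
{ intros N; induction N as [|N IH].
  - rewrite sum_O; unfold hurwitz_term; simpl INR; rewrite !Rplus_0_r; lra.
  - rewrite sum_Sn_R; unfold hurwitz_term at 2.
    assert (HN := pos_INR N). assert (Hs := Hstep (x + INR N) ltac:(lra)).
    rewrite (S_INR N). replace (x + (INR N + 1)) with (x + INR N + 1) by ring. lra. }
assert (Hr : is_lim_seq (fun n => - (/ x ^ S k + INR (S k) / 2 * / x ^ S (S k))
     - (- / (x + INR n) ^ S k + INR (S k) / 2 * / (x + INR n) ^ S (S k)))
  (- (/ x ^ S k + INR (S k) / 2 * / x ^ S (S k)) - 0)).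
{ apply (is_lim_seq_minus' (fun _ => _)); [apply is_lim_seq_const|exact Hv]. }
assert (H : - (INR (S k) * hurwitz (S (S k)) x)
  <= - (/ x ^ S k + INR (S k) / 2 * / x ^ S (S k)) - 0)
  by exact (is_lim_seq_le _ _ _ _ Hle Hl Hr).
lra.
Qed.

(** * Differentiating a pointwise limit of functions *)

(** Two applications of the mean value theorem, which give the remainder with [M] in place of
    [M / 2]. *)
Lemma taylor2_bound (f f1 f2 : R -> R) (x y r M : R) :
  (forall z, Rabs (z - x) < r -> is_derive f z (f1 z)) ->
  (forall z, Rabs (z - x) < r -> is_derive f1 z (f2 z)) ->
  (forall z, Rabs (z - x) < r -> Rabs (f2 z) <= M) ->
  Rabs (y - x) < r ->
  Rabs (f y - f x - (y - x) * f1 x) <= M * (y - x) ^ 2.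
Proof.
intros H1 H2 HM Hy.
assert (Hbt : forall z, Rmin x y <= z <= Rmax x y ->
  Rabs (z - x) <= Rabs (y - x)).
{ intros z; unfold Rmin, Rmax, Rabs.
  repeat destruct (Rle_dec _ _); repeat destruct (Rcase_abs _); lra. }
destruct (MVT_gen f x y f1) as [c [Hc Ec]].
- intros z Hz; apply H1; specialize (Hbt z ltac:(lra)); lra.
- intros z Hz; apply derivable_continuous_pt; exists (f1 z).
  apply is_derive_Reals, H1; specialize (Hbt z Hz); lra.
- assert (Hc' := Hbt c Hc).
  assert (Hbc : forall z, Rmin x c <= z <= Rmax x c ->
    Rabs (z - x) <= Rabs (c - x)).
  { intros z; unfold Rmin, Rmax, Rabs.
    repeat destruct (Rle_dec _ _); repeat destruct (Rcase_abs _); lra. }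
  destruct (MVT_gen f1 x c f2) as [d [Hd Ed]].
  + intros z Hz; apply H2; specialize (Hbc z ltac:(lra)); lra.
  + intros z Hz; apply derivable_continuous_pt; exists (f2 z).
    apply is_derive_Reals, H2; specialize (Hbc z Hz); lra.
  + assert (Hd' := Hbc d Hd).
    replace (f y - f x - (y - x) * f1 x) with (f2 d * ((c - x) * (y - x))).
    2: { replace (f1 c) with (f1 x + f2 d * (c - x)) in Ec by lra.
         replace (f y) with (f x + (f1 x + f2 d * (c - x)) * (y - x)) by lra. ring. }
    rewrite Rabs_mult. apply Rmult_le_compat; [apply Rabs_pos|apply Rabs_pos| |].
    * apply HM; lra.
    * rewrite Rabs_mult, <- (pow2_abs (y - x)); simpl; rewrite Rmult_1_r.
      apply Rmult_le_compat_r; [apply Rabs_pos|exact Hc'].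
Qed.

(** The Taylor remainder [M * (y - x) ^ 2] does not depend on [n], hence holds for the limit [F]
    with slope [l]. The convergence of the derivatives is asked at the point [x] alone. *)
Lemma is_derive_lim (f f1 f2 : nat -> R -> R) (F : R -> R) (x r M l : R) :
  0 < r -> 0 < M ->
  (forall n z, Rabs (z - x) < r -> is_derive (f n) z (f1 n z)) ->
  (forall n z, Rabs (z - x) < r -> is_derive (f1 n) z (f2 n z)) ->
  (forall n z, Rabs (z - x) < r -> Rabs (f2 n z) <= M) ->
  (forall z, Rabs (z - x) < r -> is_lim_seq (fun n => f n z) (F z)) ->
  is_lim_seq (fun n => f1 n x) l ->
  is_derive F x l.
Proof.
intros Hr HMp H1 H2 HM HF Hl.
assert (Hq : forall y, Rabs (y - x) < r ->
  Rabs (F y - F x - (y - x) * l) <= M * (y - x) ^ 2).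
{ intros y Hy.
  assert (L : is_lim_seq (fun n => Rabs (f n y - f n x - (y - x) * f1 n x))
    (Rabs (F y - F x - (y - x) * l))).
  { apply (is_lim_seq_abs _ (F y - F x - (y - x) * l)).
    apply is_lim_seq_minus'; [apply is_lim_seq_minus'|].
    - now apply HF.
    - apply HF; rewrite Rminus_diag, Rabs_R0; exact Hr.
    - now apply (is_lim_seq_mult' (fun _ => y - x)); [apply is_lim_seq_const|]. }
  apply (is_lim_seq_le _ _ _ _ 
    (fun n => taylor2_bound (f n) (f1 n) (f2 n) x y r M (H1 n) (H2 n) (HM n) Hy)
    L (is_lim_seq_const _)). }
apply is_derive_Reals; intros eps Heps.
assert (Hd : 0 < Rmin r (eps / M)).
{ apply Rmin_glb_lt; [exact Hr|]. apply Rdiv_lt_0_compat; lra. }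
exists (mkposreal _ Hd); simpl; intros h Hh0 Hh.
assert (Hh1 := Rlt_le_trans _ _ _ Hh (Rmin_l _ _)).
assert (Hh2 := Rlt_le_trans _ _ _ Hh (Rmin_r _ _)).
specialize (Hq (x + h)); replace (x + h - x) with h in Hq by ring.
specialize (Hq Hh1).
assert (Hp := Rabs_pos_lt h Hh0).
replace ((F (x + h) - F x) / h - l) with ((F (x + h) - F x - h * l) / h)
  by (field; exact Hh0).
rewrite Rabs_div by exact Hh0.
apply Rle_lt_trans with (M * Rabs h).
- apply Rmult_le_reg_r with (Rabs h); [lra|].
  unfold Rdiv; rewrite Rmult_assoc, Rinv_l by lra.
  rewrite <- (pow2_abs h) in Hq; simpl in Hq; lra.
- apply Rmult_lt_reg_r with (/ M); [now apply Rinv_0_lt_compat|].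
  replace (M * Rabs h * / M) with (Rabs h) by (field; lra). exact Hh2.
Qed.

(** * The gamma integral *)

Notation is_RInt_pos f l := (is_RInt_gen f (at_right 0) (Rbar_locally p_infty) l).

Lemma at_right_0_intro (P : R -> Prop) (d : R) :
  0 < d -> (forall t, 0 < t < d -> P t) -> at_right 0 P.
Proof.
intros Hd H; exists (mkposreal d Hd); intros t Ht Ht0.
apply H; split; [exact Ht0|].
change (Rabs (t - 0) < d) in Ht; rewrite Rminus_0_r, Rabs_pos_eq in Ht; lra.
Qed.

Lemma ex_RInt_pos (f : R -> R) (a b : R) :
  (forall t, 0 < t -> continuous f t) -> 0 < a -> 0 < b -> ex_RInt f a b.
Proof.
intros Hc Ha Hb; apply (ex_RInt_continuous f); intros z Hz; apply Hc.
destruct (Rle_dec a b) as [H|H]; unfold Rmin in Hz;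
  destruct (Rle_dec a b); lra.
Qed.

Lemma RInt_widen (f : R -> R) (a b c d : R) :
  (forall t, 0 < t -> continuous f t) -> (forall t, 0 < t -> 0 <= f t) ->
  0 < a <= b -> b <= c <= d -> RInt f b c <= RInt f a d.
Proof.
intros Hc Hp Hab Hcd.
rewrite <- (RInt_Chasles f a b d), <- (RInt_Chasles f b c d)
  by (apply ex_RInt_pos; [assumption|lra|lra]).
assert (H1 : 0 <= RInt f a b).
{ apply RInt_ge_0; [lra|apply ex_RInt_pos; [assumption|lra|lra]|].
  intros t Ht; apply Hp; lra. }
assert (H2 : 0 <= RInt f c d).
{ apply RInt_ge_0; [lra|apply ex_RInt_pos; [assumption|lra|lra]|].
  intros t Ht; apply Hp; lra. }
change plus with (fun x y : R => x + y); simpl; lra.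
Qed.

(** The integrals over [[a, b]] grow with the interval, so their supremum is the limit. The second
    conclusion will yield the positivity of [Gamma]. *)
Lemma is_RInt_pos_bounded (f : R -> R) (C : R) :
  (forall t, 0 < t -> continuous f t) -> (forall t, 0 < t -> 0 <= f t) ->
  (forall a b, 0 < a <= b -> RInt f a b <= C) ->
  exists l, is_RInt_pos f l /\ forall a b, 0 < a <= b -> RInt f a b <= l.
Proof.
intros Hc Hp HC.
destruct (completeness (fun v => exists a b, 0 < a <= b /\ v = RInt f a b))
  as [l [Hub Hlub]].
- exists C; intros v [a [b [Hab ->]]]; now apply HC.
- exists (RInt f 1 1); exists 1, 1; split; [lra|reflexivity].
- assert (Hle : forall a b, 0 < a <= b -> RInt f a b <= l).
  { intros a b Hab; apply Hub; now exists a, b. }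
  exists l; split; [|exact Hle].
  intros P [eps HP].
  destruct (Classical_Prop.classic
    (exists a b, 0 < a <= b /\ l - eps < RInt f a b)) as [[a0 [b0 [Hab0 H0]]]|Hn].
  + apply Filter_prod with (fun a => 0 < a < a0) (fun b => b0 < b).
    * apply at_right_0_intro with a0; [lra|tauto].
    * exists b0; tauto.
    * intros a b Ha Hb; exists (RInt f a b); split.
      { apply (RInt_correct f), ex_RInt_pos; [assumption|lra|simpl; lra]. }
      apply HP; change (Rabs (RInt f a b - l) < eps).
      assert (H1 := RInt_widen f a a0 b0 b Hc Hp ltac:(lra) ltac:(lra)).
      assert (H2 := Hle a b ltac:(lra)).
      apply Rabs_lt_between; lra.
  + exfalso; assert (Heps := cond_pos eps).
    assert (Hl : l <= l - eps); [|lra].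
    apply Hlub; intros v [a [b [Hab ->]]].
    apply Rnot_lt_le; intros H; apply Hn; now exists a, b.
Qed.

Lemma is_RInt_pos_derive (F f : R -> R) (la lb : R) :
  (forall t, 0 < t -> is_derive F t (f t)) ->
  (forall t, 0 < t -> continuous f t) ->
  (forall eps, 0 < eps ->
     exists d, 0 < d /\ forall t, 0 < t < d -> Rabs (F t - la) < eps) ->
  (forall eps, 0 < eps -> exists M, forall t, M < t -> Rabs (F t - lb) < eps) ->
  is_RInt_pos f (lb - la).
Proof.
intros HF Hc Ha Hb P [eps HP]; assert (Heps := cond_pos eps).
destruct (Ha (eps / 2) ltac:(lra)) as [d [Hd Ha']].
destruct (Hb (eps / 2) ltac:(lra)) as [M Hb'].
apply Filter_prod with (fun a => 0 < a < d) (fun b => Rmax M 0 < b).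
- apply at_right_0_intro with d; [lra|tauto].
- exists (Rmax M 0); tauto.
- intros a b Ha0 Hb0; exists (F b - F a).
  assert (HM := Rmax_l M 0); assert (HM0 := Rmax_r M 0).
  assert (Hpos : forall z, Rmin a b <= z -> 0 < z).
  { intros z; unfold Rmin; destruct (Rle_dec a b); lra. }
  split.
  + apply (is_RInt_derive F f); simpl; intros z [Hz _];
      [apply HF|apply Hc]; now apply Hpos.
  + apply HP; change (Rabs (F b - F a - (lb - la)) < eps).
    specialize (Ha' a Ha0); specialize (Hb' b ltac:(lra)).
    replace (F b - F a - (lb - la)) with ((F b - lb) + - (F a - la)) by ring.
    eapply Rle_lt_trans; [apply Rabs_triang|]; rewrite Rabs_Ropp; lra.
Qed.

Lemma filter_prod_pos (P : R * R -> Prop) :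
  (forall a b, 0 < a <= b -> P (a, b)) ->
  filter_prod (at_right 0) (Rbar_locally p_infty) P.
Proof.
intros H; apply Filter_prod with (fun a => 0 < a < 1) (fun b => 1 < b).
- apply at_right_0_intro with 1; [lra|tauto].
- exists 1; tauto.
- intros a b Ha Hb; apply H; lra.
Qed.

Lemma is_RInt_pos_le (f g : R -> R) (lf lg : R) :
  (forall t, 0 < t -> 0 <= f t <= g t) ->
  is_RInt_pos f lf -> is_RInt_pos g lg -> lf <= lg.
Proof.
intros H Hf Hg; apply Rle_trans with (Rabs lf); [apply Rle_abs|].
apply (RInt_gen_norm (V := R_CompleteNormedModule)
  (Fa := at_right 0) (Fb := Rbar_locally p_infty) f g lf lg).
- apply filter_prod_pos; intros a b Hab; simpl; lra.
- apply filter_prod_pos; intros a b Hab t Ht; simpl in Ht.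
  change (norm (f t)) with (Rabs (f t)).
  destruct (H t ltac:(lra)); rewrite Rabs_pos_eq; lra.
- exact Hf.
- exact Hg.
Qed.

Definition gamma_integrand (x t : R) : R := Rpower t (x - 1) * exp (- t).

Lemma gamma_integrand_exp (x t : R) :
  gamma_integrand x t = exp ((x - 1) * ln t - t).
Proof. unfold gamma_integrand, Rpower; rewrite <- exp_plus; reflexivity. Qed.

Lemma gamma_integrand_pos (x t : R) : 0 < gamma_integrand x t.
Proof. rewrite gamma_integrand_exp; apply exp_pos. Qed.

Lemma gamma_integrand_continuous (x t : R) :
  0 < t -> continuous (gamma_integrand x) t.
Proof.
intros Ht; apply (ex_derive_continuous (gamma_integrand x)).
unfold gamma_integrand, Rpower; auto_derive; lra.
Qed.

Lemma ln_le_minus_1 (u : R) : 0 < u -> ln u <= u - 1.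
Proof.
intros Hu; assert (H := exp_ineq1_le (ln u)); rewrite exp_ln in H; lra.
Qed.

(** The tangent to [ln] at [p]; it says that [t^p exp (- t)] is largest at [t = p]. The decay
    estimates at infinity below all come from it. *)
Lemma ln_mult_le (p t : R) : 0 < p -> 0 < t -> p * ln t <= p * ln p + t - p.
Proof.
intros Hp Ht.
assert (H := ln_le_minus_1 (t / p) ltac:(apply Rdiv_lt_0_compat; lra)).
unfold Rdiv in H; rewrite ln_mult, ln_Rinv in H;
  [|lra|lra|apply Rinv_0_lt_compat; lra].
apply Rmult_le_compat_l with (r := p) in H; [|lra].
replace (p * (t * / p - 1)) with (t - p) in H by (field; lra). lra.
Qed.

Lemma Rle_exp (x y : R) : x <= y -> exp x <= exp y.
Proof. intros [H| ->]; [left; now apply exp_increasing|right; reflexivity]. Qed.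

(* [C (t/(1+t))^x] is a bounded function whose derivative dominates the integrand. *)
Lemma gamma_integrand_RInt_bound (x : R) :
  0 < x ->
  exists C, forall a b, 0 < a <= b -> RInt (gamma_integrand x) a b <= C.
Proof.
intros Hx.
(* [C * x] is the maximum of [(1 + t)^(x + 1) exp (- t)], reached at [t = x]; that function is the
   ratio of the integrand to [t^(x - 1) / (1 + t)^(x + 1)]. *)
set (C := exp ((x + 1) * ln (x + 1) - x) / x).
assert (HC : 0 < C) by (apply Rdiv_lt_0_compat; [apply exp_pos|lra]).
exists C; intros a b Hab.
set (G := fun t => C * exp (x * (ln t - ln (1 + t)))).
set (g := fun t => C * (x * (/ t - / (1 + t)) * exp (x * (ln t - ln (1 + t))))).
assert (HG : forall t, 0 < t -> is_derive G t (g t)).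
{ intros t Ht; unfold G, g, Rminus; auto_derive; [lra|field; lra]. }
assert (Hgc : forall t, 0 < t -> continuous g t).
{ intros t Ht; apply (ex_derive_continuous g); unfold g; auto_derive; lra. }
assert (HI : is_RInt g a b (G b - G a)).
{ apply (is_RInt_derive G g); rewrite Rmin_left by lra; intros z Hz;
    [apply HG|apply Hgc]; lra. }
apply Rle_trans with (RInt g a b).
- apply RInt_le; [lra|apply ex_RInt_pos; [|lra|lra]|eexists; exact HI|].
  { intros t Ht; now apply gamma_integrand_continuous. }
  intros t [Ht _]; assert (Ht0 : 0 < t) by lra.
  rewrite gamma_integrand_exp; unfold g, C.
  replace (/ t - / (1 + t)) with (exp (- ln t - ln (1 + t))).
  2: { unfold Rminus; rewrite exp_plus, !exp_Ropp, !exp_ln by lra. field; lra. }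
  replace (exp ((x + 1) * ln (x + 1) - x) / x *
    (x * exp (- ln t - ln (1 + t)) * exp (x * (ln t - ln (1 + t)))))
    with (exp ((x + 1) * ln (x + 1) - x) *
    (exp (- ln t - ln (1 + t)) * exp (x * (ln t - ln (1 + t))))) by (field; lra).
  rewrite <- !exp_plus; apply Rle_exp.
  assert (H := ln_mult_le (x + 1) (1 + t) ltac:(lra) ltac:(lra)). lra.
- rewrite (is_RInt_unique g a b _ HI).
  assert (Hb : G b <= C * 1).
  { apply Rmult_le_compat_l; [lra|].
    apply Rle_trans with (exp 0); [apply Rle_exp|rewrite exp_0; lra].
    assert (ln b <= ln (1 + b)) by (apply ln_le; lra).
    assert (0 <= x * (ln (1 + b) - ln b)) by (apply Rmult_le_pos; lra). lra. }
  assert (0 < G a) by (apply Rmult_lt_0_compat; [lra|apply exp_pos]). lra.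
Qed.

Lemma Gamma_spec (x : R) :
  0 < x ->
  is_RInt_pos (gamma_integrand x) (Gamma x) /\ 0 < Gamma x.
Proof.
intros Hx; destruct (gamma_integrand_RInt_bound x Hx) as [C HC].
destruct (is_RInt_pos_bounded (gamma_integrand x) C) as [l [Hl Hle]].
- intros t Ht; now apply gamma_integrand_continuous.
- intros t _; apply Rlt_le, gamma_integrand_pos.
- exact HC.
- assert (E : Gamma x = l).
  { apply (is_RInt_gen_unique (V := R_CompleteNormedModule)
      (Fa := at_right 0) (Fb := Rbar_locally p_infty) (gamma_integrand x) l Hl). }
  rewrite E; split; [exact Hl|].
  apply Rlt_le_trans with (2 := Hle 1 2 ltac:(lra)).
  apply RInt_gt_0; [lra|intros t _; apply gamma_integrand_pos|].
  intros t Ht; apply gamma_integrand_continuous; lra.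
Qed.

Lemma Gamma_pos (x : R) : 0 < x -> 0 < Gamma x.
Proof. apply Gamma_spec. Qed.

Lemma gamma_integrand_S (x t : R) :
  0 < t -> gamma_integrand (x + 1) t = t * gamma_integrand x t.
Proof.
intros Ht; rewrite !gamma_integrand_exp.
rewrite <- (exp_ln t) at 3 by exact Ht.
rewrite <- exp_plus; f_equal; ring.
Qed.

(** Integration by parts in one stroke: [F t = - t^x exp (- t)] is a primitive of the difference of
    the two integrands and tends to 0 at both ends. *)
Lemma Gamma_rec (x : R) : 0 < x -> Gamma (x + 1) = x * Gamma x.
Proof.
intros Hx.
set (F := fun t => - exp (x * ln t) * exp (- t)).
assert (HF : is_RInt_pos
  (fun t => minus (gamma_integrand (x + 1) t) (scal x (gamma_integrand x t)))
  (0 - 0)).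
{ apply is_RInt_pos_derive with F.
  - intros t Ht; rewrite gamma_integrand_S by exact Ht.
    rewrite gamma_integrand_exp; unfold F; auto_derive; [lra|].
    change minus with Rminus; change scal with Rmult.
    unfold Rminus at 1 2 4; rewrite !exp_plus.
    replace (exp (x * ln t)) with (t * exp ((x - 1) * ln t)).
    2: { rewrite <- (exp_ln t) at 1 by exact Ht; rewrite <- exp_plus; f_equal; ring. }
    field; lra.
  - intros t Ht; apply (ex_derive_continuous
      (fun t => gamma_integrand (x + 1) t - x * gamma_integrand x t)).
    unfold gamma_integrand, Rpower; auto_derive; lra.
  (* This is [eps^(1/x)], below which [t^x < eps]. *)
  - intros eps Heps; exists (exp (ln eps / x)); split; [apply exp_pos|].
    intros t Ht; unfold F.
    replace (- exp (x * ln t) * exp (- t) - 0)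
      with (- (exp (x * ln t + - t))) by (rewrite exp_plus; ring).
    rewrite Rabs_Ropp, Rabs_pos_eq by (apply Rlt_le, exp_pos).
    rewrite <- (exp_ln eps) by exact Heps; apply exp_increasing.
    assert (H : ln t < ln eps / x).
    { rewrite <- (ln_exp (ln eps / x)); apply ln_increasing; lra. }
    apply Rmult_lt_compat_l with (r := x) in H; [|exact Hx].
    replace (x * (ln eps / x)) with (ln eps) in H by (field; lra). lra.
  (* [K] bounds [t^(x + 1) exp (- t)], so that [t^x exp (- t)] is at most [K / t]. *)
  - intros eps Heps; set (K := exp ((x + 1) * ln (x + 1))).
    assert (HK : 0 < K) by apply exp_pos.
    exists (K / eps); intros t Ht; unfold F.
    assert (Ht0 : 0 < t) by (apply Rlt_trans with (2 := Ht), Rdiv_lt_0_compat; lra).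
    replace (- exp (x * ln t) * exp (- t) - 0)
      with (- (exp (x * ln t + - t))) by (rewrite exp_plus; ring).
    rewrite Rabs_Ropp, Rabs_pos_eq by (apply Rlt_le, exp_pos).
    apply Rle_lt_trans with (K / t).
    + replace (K / t) with (exp ((x + 1) * ln (x + 1) + - ln t)).
      2: { rewrite exp_plus, exp_Ropp, exp_ln by exact Ht0; reflexivity. }
      apply Rle_exp.
      assert (H := ln_mult_le (x + 1) t ltac:(lra) Ht0). lra.
    + apply Rmult_lt_reg_r with (t / eps); [apply Rdiv_lt_0_compat; lra|].
      replace (K / t * (t / eps)) with (K / eps) by (field; lra).
      replace (eps * (t / eps)) with t by (field; lra). exact Ht. }
assert (HG := is_RInt_gen_minus (V := R_NormedModule)
  (Fa := at_right 0) (Fb := Rbar_locally p_infty)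
  (gamma_integrand (x + 1)) (fun t => scal x (gamma_integrand x t)) _ _
  (proj1 (Gamma_spec (x + 1) ltac:(lra)))
  (is_RInt_gen_scal (gamma_integrand x) x _ (proj1 (Gamma_spec x Hx)))).
assert (E1 := is_RInt_gen_unique (V := R_CompleteNormedModule)
  (Fa := at_right 0) (Fb := Rbar_locally p_infty) _ _ HF).
assert (E2 := is_RInt_gen_unique (V := R_CompleteNormedModule)
  (Fa := at_right 0) (Fb := Rbar_locally p_infty) _ _ HG).
assert (E3 : Gamma (x + 1) - x * Gamma x = 0 - 0) by (rewrite <- E1; symmetry; exact E2).
lra.
Qed.

(** Convexity of [exp]: its tangent at [s * L] is compared with it at [L] and at 0, with weights [s]
    and [1 - s]; the linear terms cancel. *)
Lemma exp_mult_le (s L : R) : 0 <= s <= 1 -> exp (s * L) <= 1 - s + s * exp L.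
Proof.
intros Hs; set (w := exp (s * L)).
assert (Hw : 0 < w) by apply exp_pos.
assert (H1 : exp L = w * exp ((1 - s) * L))
  by (unfold w; rewrite <- exp_plus; f_equal; ring).
assert (H2 : 1 = w * exp (- (s * L)))
  by (unfold w; rewrite <- exp_plus, Rplus_opp_r, exp_0; reflexivity).
assert (H3 : w * (1 + (1 - s) * L) <= exp L).
{ rewrite H1; apply Rmult_le_compat_l; [lra|apply exp_ineq1_le]. }
assert (H4 : w * (1 + - (s * L)) <= 1).
{ rewrite H2 at 2; apply Rmult_le_compat_l; [lra|apply exp_ineq1_le]. }
apply Rmult_le_compat_l with (r := s) in H3; [|lra].
apply Rmult_le_compat_l with (r := 1 - s) in H4; [|lra]. lra.
Qed.

(* Integrate the tangent-line bound [t^s <= a^s (1 - s + s t / a)]. *)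
Lemma Gamma_shift_le (a s : R) :
  0 < a -> 0 <= s <= 1 -> Gamma (a + s) <= exp (s * ln a) * Gamma a.
Proof.
intros Ha Hs.
replace (exp (s * ln a) * Gamma a) with
  (exp (s * ln a) * ((1 - s) * Gamma a + s / a * Gamma (a + 1)))
  by (rewrite Gamma_rec by exact Ha; field; lra).
apply is_RInt_pos_le with (gamma_integrand (a + s))
  (fun t => scal (exp (s * ln a)) (plus (scal (1 - s) (gamma_integrand a t))
     (scal (s / a) (gamma_integrand (a + 1) t)))).
- intros t Ht; split; [apply Rlt_le, gamma_integrand_pos|].
  rewrite (gamma_integrand_S a t Ht).
  change scal with Rmult; change plus with Rplus.
  replace (gamma_integrand (a + s) t)
    with (gamma_integrand a t * exp (s * ln a) * exp (s * (ln t - ln a))).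
  2: { rewrite !gamma_integrand_exp, <- !exp_plus; f_equal; ring. }
  assert (H := exp_mult_le s (ln t - ln a) Hs).
  replace (exp (ln t - ln a)) with (t / a) in H.
  2: { unfold Rminus; rewrite exp_plus, exp_Ropp, !exp_ln by lra; reflexivity. }
  assert (Hp : 0 < gamma_integrand a t * exp (s * ln a))
    by (apply Rmult_lt_0_compat; [apply gamma_integrand_pos|apply exp_pos]).
  apply Rmult_le_compat_l with (r := gamma_integrand a t * exp (s * ln a)) in H;
    [|lra].
  eapply Rle_trans; [exact H|right; field; lra].
- apply Gamma_spec; lra.
- apply (is_RInt_gen_scal (V := R_NormedModule)).
  apply (is_RInt_gen_plus (V := R_NormedModule));
    apply (is_RInt_gen_scal (V := R_NormedModule)); apply Gamma_spec; lra.
Qed.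

Lemma Gamma_1 : Gamma 1 = 1.
Proof.
assert (H : is_RInt_pos (gamma_integrand 1) (0 - - (1))).
{ apply is_RInt_pos_derive with (fun t => - exp (- t)).
  - intros t Ht; rewrite gamma_integrand_exp; auto_derive; [trivial|].
    replace ((1 - 1) * ln t - t) with (- t) by ring. ring.
  - intros t Ht; now apply gamma_integrand_continuous.
  - intros eps Heps; exists eps; split; [exact Heps|]; intros t Ht.
    assert (H1 := exp_ineq1_le (- t)).
    assert (H2 : exp (- t) < 1) by (rewrite <- exp_0; apply exp_increasing; lra).
    apply Rabs_lt_between; lra.
  - intros eps Heps; exists (- ln eps); intros t Ht.
    assert (H1 : exp (- t) < eps).
    { rewrite <- (exp_ln eps) by exact Heps; apply exp_increasing; lra. }
    assert (H2 := exp_pos (- t)). apply Rabs_lt_between; lra. }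
assert (E := is_RInt_gen_unique (V := R_CompleteNormedModule)
  (Fa := at_right 0) (Fb := Rbar_locally p_infty) _ _ H).
replace 1 with (0 - - (1)) at 2 by ring. exact E.
Qed.

Lemma Gamma_fact (n : nat) : Gamma (INR (S n)) = INR (fact n).
Proof.
induction n as [|n IH]; [exact Gamma_1|].
rewrite S_INR, Gamma_rec, IH by (apply lt_0_INR; lia).
now rewrite <- mult_INR.
Qed.

(** * Polygamma functions as series *)

Lemma ln_diff_le (a b : R) : 0 < a -> 0 < b -> ln a - ln b <= (a - b) / b.
Proof.
intros Ha Hb; assert (H := ln_le_minus_1 (a / b) ltac:(now apply Rdiv_lt_0_compat)).
unfold Rdiv in H at 1; rewrite ln_mult, ln_Rinv in H;
  [|lra|lra|now apply Rinv_0_lt_compat].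
replace ((a - b) / b) with (a / b - 1) by (field; lra). lra.
Qed.

Lemma inv_INR_S_pos (n : nat) : 0 < / INR (S n).
Proof. apply Rinv_0_lt_compat, lt_0_INR; lia. Qed.

Lemma inv_INR_S_lim : is_lim_seq (fun n => / INR (S n)) 0.
Proof.
apply is_lim_seq_ext with (fun n => / (1 + INR n) ^ 1).
- intros n; rewrite S_INR, pow_1, Rplus_comm; reflexivity.
- apply inv_pow_shift_lim; lra.
Qed.

(** With [N = S n], this is the logarithm of [Gamma (N + x) / (Gamma N * N^x)], because
    [Gamma N = n!]. *)
Definition ln_Gamma_defect (n : nat) (x : R) : R :=
  ln (Gamma (INR (S n) + x)) - ln (INR (fact n)) - x * ln (INR (S n)).

Lemma ln_Gamma_rec (x : R) :
  0 < x -> ln (Gamma (x + 1)) = ln x + ln (Gamma x).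
Proof.
intros Hx; rewrite Gamma_rec by exact Hx; apply ln_mult; [exact Hx|now apply Gamma_pos].
Qed.

Lemma ln_Gamma_shift_le (a s : R) :
  0 < a -> 0 <= s <= 1 -> ln (Gamma (a + s)) <= s * ln a + ln (Gamma a).
Proof.
intros Ha Hs; rewrite <- (ln_exp (s * ln a)) at 1.
rewrite <- ln_mult by (apply exp_pos || now apply Gamma_pos).
apply ln_le; [apply Gamma_pos; lra|now apply Gamma_shift_le].
Qed.

(** Shifting from [N] to [N + s] shows that the defect is at most 0. Shifting from [N + s] by
    [1 - s] up to [N + 1] bounds it below by [- (1 - s) ln ((N + s) / N)], which is at least
    [- s (1 - s) / N]. *)
Lemma ln_Gamma_defect_unit (n : nat) (s : R) :
  0 <= s <= 1 -> Rabs (ln_Gamma_defect n s) <= 1 * / INR (S n).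
Proof.
intros Hs; unfold ln_Gamma_defect; rewrite <- Gamma_fact.
assert (HN : 0 < INR (S n)) by (apply lt_0_INR; lia).
assert (Hi := inv_INR_S_pos n).
set (N := INR (S n)) in *.
assert (H1 := ln_Gamma_shift_le N s HN Hs).
assert (H2 := ln_Gamma_shift_le (N + s) (1 - s) ltac:(lra) ltac:(lra)).
replace (N + s + (1 - s)) with (N + 1) in H2 by ring.
rewrite ln_Gamma_rec in H2 by exact HN.
assert (H3 := ln_diff_le (N + s) N ltac:(lra) HN).
replace ((N + s - N) / N) with (s * / N) in H3 by (field; lra).
assert (H4 : (1 - s) * (ln (N + s) - ln N) <= (1 - s) * (s * / N))
  by (apply Rmult_le_compat_l; lra).
assert (H5 : (1 - s) * (s * / N) <= 1 * / N).
{ rewrite <- Rmult_assoc; apply Rmult_le_compat_r; [lra|nra]. }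
apply Rabs_le; lra.
Qed.

(** Induction on the integer part: passing from [y] to [y + 1] adds [ln ((N + y) / N)], which lies
    between 0 and [y / N]. *)
Lemma ln_Gamma_defect_bound (x : R) :
  0 <= x ->
  exists C, forall n, Rabs (ln_Gamma_defect n x) <= C * / INR (S n).
Proof.
intros Hx; destruct (nfloor_ex x Hx) as [m Hm].
assert (H : forall s, 0 <= s <= 1 -> exists C, forall n,
  Rabs (ln_Gamma_defect n (s + INR m)) <= C * / INR (S n)).
{ intros s Hs; clear Hm; induction m as [|m [C HC]].
  - exists 1; intros n; simpl INR; rewrite Rplus_0_r; now apply ln_Gamma_defect_unit.
  - exists (C + (s + INR m)); intros n; specialize (HC n).
    unfold ln_Gamma_defect in *; rewrite (S_INR m).
    assert (HN : 0 < INR (S n)) by (apply lt_0_INR; lia).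
    assert (Hm := pos_INR m).
    set (N := INR (S n)) in *; set (y := s + INR m) in *.
    assert (Hy : 0 <= y) by (unfold y; lra).
    replace (N + (s + (INR m + 1))) with (N + y + 1) by (unfold y; ring).
    replace (s + (INR m + 1)) with (y + 1) by (unfold y; ring).
    rewrite ln_Gamma_rec by lra.
    assert (H1 := ln_diff_le (N + y) N ltac:(lra) HN).
    replace ((N + y - N) / N) with (y * / N) in H1 by (field; lra).
    assert (H2 : ln N <= ln (N + y)) by (apply ln_le; lra).
    apply Rabs_le_between in HC; apply Rabs_le; lra. }
destruct (H (x - INR m) ltac:(lra)) as [C HC]; exists C.
replace (x - INR m + INR m) with x in HC by ring; exact HC.
Qed.

(** The logarithm of Euler's quotient [(n + 1)^x n! / (x (x + 1) ... (x + n))]. *)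
Definition ln_Gamma_seq (n : nat) (x : R) : R :=
  x * ln (INR (S n)) + ln (INR (fact n)) - sum_n (fun j => ln (x + INR j)) n.

Lemma ln_Gamma_sum (n : nat) (x : R) :
  0 < x ->
  ln (Gamma (INR (S n) + x)) = ln (Gamma x) + sum_n (fun j => ln (x + INR j)) n.
Proof.
intros Hx; induction n as [|n IH].
- rewrite sum_O; simpl INR; rewrite Rplus_0_r, Rplus_comm, ln_Gamma_rec by exact Hx. ring.
- assert (H := pos_INR (S n)).
  rewrite sum_Sn_R, (S_INR (S n)).
  replace (INR (S n) + 1 + x) with (INR (S n) + x + 1) by ring.
  rewrite ln_Gamma_rec, IH, (Rplus_comm x (INR (S n))) by lra. ring.
Qed.

Lemma ln_Gamma_lim (x : R) :
  0 < x -> is_lim_seq (fun n => ln_Gamma_seq n x) (ln (Gamma x)).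
Proof.
intros Hx; destruct (ln_Gamma_defect_bound x ltac:(lra)) as [C HC].
apply is_lim_seq_ext with (fun n => ln (Gamma x) - ln_Gamma_defect n x).
{ intros n; unfold ln_Gamma_defect, ln_Gamma_seq.
  rewrite ln_Gamma_sum by exact Hx; ring. }
replace (Finite (ln (Gamma x))) with (Finite (ln (Gamma x) - 0))
  by (f_equal; ring).
apply (is_lim_seq_minus' (fun _ => _)); [apply is_lim_seq_const|].
assert (HL : is_lim_seq (fun n => C * / INR (S n)) 0).
{ replace 0 with (C * 0) by ring.
  apply (is_lim_seq_mult' (fun _ => C)); [apply is_lim_seq_const|apply inv_INR_S_lim]. }
apply is_lim_seq_le_le with (fun n => - (C * / INR (S n))) (fun n => C * / INR (S n)).
- intros n; apply Rabs_le_between, HC.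
- replace 0 with (- 0) by ring. now apply (proj1 (is_lim_seq_opp _ (Finite _))).
- exact HL.
Qed.

(** The derivative of [ln_Gamma_seq n] in [x]. *)
Definition digamma_seq (n : nat) (x : R) : R :=
  ln (INR (S n)) - sum_n (hurwitz_term 1 x) n.

Lemma sum_n_inv_compare (n : nat) (x : R) :
  0 < x ->
  ln (x + INR n + 1) - ln x <= sum_n (hurwitz_term 1 x) n.
Proof.
intros Hx; induction n as [|n IH].
- rewrite sum_O; unfold hurwitz_term; simpl INR; rewrite !Rplus_0_r, pow_1.
  assert (H := ln_diff_le (x + 1) x ltac:(lra) Hx).
  replace ((x + 1 - x) / x) with (/ x) in H by (field; lra). exact H.
- rewrite sum_Sn_R; unfold hurwitz_term at 2; rewrite pow_1, S_INR.
  assert (Hn := pos_INR n).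
  assert (H := ln_diff_le (x + (INR n + 1) + 1) (x + (INR n + 1)) ltac:(lra) ltac:(lra)).
  replace ((x + (INR n + 1) + 1 - (x + (INR n + 1))) / (x + (INR n + 1)))
    with (/ (x + (INR n + 1))) in H by (field; lra).
  replace (x + INR n + 1) with (x + (INR n + 1)) in IH by ring. lra.
Qed.

(** As for Euler's constant, the sum minus [ln (x + n)] decreases and is bounded below; replacing
    [ln (x + n)] by [ln (n + 1)] costs a term of order [1/n]. Only existence is obtained here: the
    value is identified in [psi_lim]. *)
Lemma digamma_lim (x : R) :
  0 < x -> exists l : R, is_lim_seq (fun n => digamma_seq n x) l.
Proof.
intros Hx.
destruct (ex_finite_lim_seq_decr
  (fun n => sum_n (hurwitz_term 1 x) n - ln (x + INR n)) (- ln x)) as [l Hl].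
- intros n; rewrite sum_Sn_R; unfold hurwitz_term at 2; rewrite pow_1.
  assert (Hn := pos_INR n); rewrite S_INR.
  assert (H := ln_diff_le (x + INR n) (x + (INR n + 1)) ltac:(lra) ltac:(lra)).
  replace ((x + INR n - (x + (INR n + 1))) / (x + (INR n + 1)))
    with (- / (x + (INR n + 1))) in H by (field; lra). lra.
- intros n; assert (H := sum_n_inv_compare n x Hx); assert (Hn := pos_INR n).
  assert (ln (x + INR n) <= ln (x + INR n + 1)) by (apply ln_le; lra). lra.
- exists (- l - 0).
  apply is_lim_seq_ext with
    (fun n => - (sum_n (hurwitz_term 1 x) n - ln (x + INR n))
              - (ln (x + INR n) - ln (INR (S n)))).
  { intros n; unfold digamma_seq; ring. }
  apply is_lim_seq_minus'; [now apply (proj1 (is_lim_seq_opp _ (Finite _)))|].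
  apply is_lim_seq_le_le with
    (fun n => (x - 1) * / (x + INR n) ^ 1) (fun n => (x - 1) * / INR (S n)).
  + intros n; assert (Hn := pos_INR n); rewrite pow_1, S_INR.
    assert (H1 := ln_diff_le (x + INR n) (INR n + 1) ltac:(lra) ltac:(lra)).
    assert (H2 := ln_diff_le (INR n + 1) (x + INR n) ltac:(lra) ltac:(lra)).
    replace (x + INR n - (INR n + 1)) with (x - 1) in H1 by ring.
    replace (INR n + 1 - (x + INR n)) with (- (x - 1)) in H2 by ring.
    unfold Rdiv in H1, H2; lra.
  + replace 0 with ((x - 1) * 0) by ring.
    apply (is_lim_seq_mult' (fun _ => x - 1)); [apply is_lim_seq_const|].
    now apply inv_pow_shift_lim.
  + replace 0 with ((x - 1) * 0) by ring.
    apply (is_lim_seq_mult' (fun _ => x - 1)); [apply is_lim_seq_const|].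
    apply inv_INR_S_lim.
Qed.

Lemma hurwitz_term_derive (p n : nat) (x : R) :
  0 < x ->
  is_derive (fun y => hurwitz_term p y n) x (- INR p * hurwitz_term (S p) x n).
Proof.
intros Hx; assert (Hn := pos_INR n); unfold hurwitz_term.
assert (Hp : forall q, (x + INR n) ^ q <> 0) by (intros q; apply pow_nonzero; lra).
destruct p as [|p].
- simpl; auto_derive; [lra|ring].
- auto_derive; [exact (Hp (S p))|].
  change (match p with 0%nat => 1 | S _ => INR p + 1 end) with (INR (S p)).
  replace ((x + INR n) ^ S (S p)) with ((x + INR n) * ((x + INR n) * (x + INR n) ^ p))
    by reflexivity.
  field; split; [apply Hp|lra].
Qed.

Lemma hurwitz_partial_derive (p n : nat) (x : R) :
  0 < x ->
  is_derive (fun y => sum_n (hurwitz_term p y) n) x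
    (- INR p * sum_n (hurwitz_term (S p) x) n).
Proof.
intros Hx.
rewrite <- (sum_n_mult_l (- INR p) (hurwitz_term (S p) x)).
apply (is_derive_sum_n (fun j y => hurwitz_term p y j)).
intros j _; now apply hurwitz_term_derive.
Qed.

Lemma half_ball_pos (x z : R) : 0 < x -> Rabs (z - x) < x / 2 -> x / 2 < z.
Proof. intros Hx Hz; apply Rabs_lt_between in Hz; lra. Qed.

(** The bound at the left end [x] serves all [z] to its right and all [n]. It supplies the uniform
    bound on second derivatives for [is_derive_lim], on the ball of radius half its centre. *)
Lemma hurwitz_partial_abs_bound (p n : nat) (x z : R) :
  0 < x -> x < z ->
  Rabs (sum_n (hurwitz_term (S (S p)) z) n) <= hurwitz_bound p x.
Proof.
intros Hx Hz; rewrite Rabs_pos_eq.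
- apply Rle_trans with (2 := hurwitz_partial_bound p x n Hx).
  apply sum_n_m_le; intros j; apply hurwitz_term_decr; lra.
- induction n as [|n IH].
  + rewrite sum_O; apply Rlt_le, hurwitz_term_pos; lra.
  + apply Rle_trans with (1 := IH), hurwitz_partial_incr; lra.
Qed.

Lemma hurwitz_bound_pos (p : nat) (x : R) : 0 < x -> 0 < hurwitz_bound p x.
Proof.
intros Hx; assert (H : 0 < / x) by now apply Rinv_0_lt_compat.
repeat apply Rmult_lt_0_compat; try lra; now apply pow_lt.
Qed.

Lemma hurwitz_derive (p : nat) (x : R) :
  0 < x ->
  is_derive (hurwitz (S (S p))) x (- INR (S (S p)) * hurwitz (S (S (S p))) x).
Proof.
intros Hx.
set (a := - INR (S (S p))); set (b := - INR (S (S (S p)))).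
(* The summand 1 in [1 + Rabs a * Rabs b] makes the bound visibly positive. *)
apply (is_derive_lim
  (fun n y => sum_n (hurwitz_term (S (S p)) y) n)
  (fun n y => a * sum_n (hurwitz_term (S (S (S p))) y) n)
  (fun n y => a * (b * sum_n (hurwitz_term (S (S (S (S p)))) y) n)) _ x (x / 2)
  ((1 + Rabs a * Rabs b) * hurwitz_bound (S (S p)) (x / 2))).
- lra.
- assert (H := hurwitz_bound_pos (S (S p)) (x / 2) ltac:(lra)).
  apply Rmult_lt_0_compat; [|exact H].
  assert (Ha := Rabs_pos a); assert (Hb := Rabs_pos b).
  assert (0 <= Rabs a * Rabs b) by now apply Rmult_le_pos. lra.
- intros n z Hz; apply half_ball_pos in Hz; [|exact Hx].
  apply hurwitz_partial_derive; lra.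
- intros n z Hz; apply half_ball_pos in Hz; [|exact Hx].
  apply (is_derive_scal (fun y => sum_n (hurwitz_term (S (S (S p))) y) n) z a).
  apply hurwitz_partial_derive; lra.
- intros n z Hz; apply half_ball_pos in Hz; [|exact Hx].
  assert (H := hurwitz_partial_abs_bound (S (S p)) n (x / 2) z ltac:(lra) Hz).
  rewrite <- Rmult_assoc, !Rabs_mult.
  apply Rmult_le_compat; [|apply Rabs_pos|lra|exact H].
  apply Rmult_le_pos; apply Rabs_pos.
- intros z Hz; apply half_ball_pos in Hz; [|exact Hx]; apply hurwitz_lim; lra.
- apply (is_lim_seq_mult' (fun _ => a)); [apply is_lim_seq_const|].
  now apply hurwitz_lim.
Qed.

Lemma ln_Gamma_derive (x l : R) :
  0 < x -> is_lim_seq (fun n => digamma_seq n x) l ->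
  is_derive (fun y => ln (Gamma y)) x l.
Proof.
intros Hx Hl.
apply (is_derive_lim ln_Gamma_seq digamma_seq
  (fun n y => sum_n (hurwitz_term 2 y) n) _ x (x / 2) (hurwitz_bound 0 (x / 2))).
- lra.
- apply hurwitz_bound_pos; lra.
- intros n z Hz; apply half_ball_pos in Hz; [|exact Hx].
  unfold ln_Gamma_seq, digamma_seq.
  apply (is_derive_minus (fun y => y * ln (INR (S n)) + ln (INR (fact n)))
    (fun y => sum_n (fun j => ln (y + INR j)) n)).
  + generalize (ln (INR (S n))) (ln (INR (fact n))); intros a b.
    auto_derive; [trivial|ring].
  + apply (is_derive_sum_n (fun j y => ln (y + INR j))); intros j _.
    assert (Hj := pos_INR j); unfold hurwitz_term.
    auto_derive; [lra|rewrite pow_1; ring].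
- intros n z Hz; apply half_ball_pos in Hz; [|exact Hx].
  unfold digamma_seq.
  replace (sum_n (hurwitz_term 2 z) n)
    with (0 - (- INR 1 * sum_n (hurwitz_term 2 z) n)) by (simpl INR; ring).
  apply (is_derive_minus (fun _ => ln (INR (S n)))
    (fun y => sum_n (hurwitz_term 1 y) n)).
  + apply (is_derive_const (ln (INR (S n)))).
  + apply hurwitz_partial_derive; lra.
- intros n z Hz; apply half_ball_pos in Hz; [|exact Hx].
  apply hurwitz_partial_abs_bound; lra.
- intros z Hz; apply half_ball_pos in Hz; [|exact Hx]; apply ln_Gamma_lim; lra.
- exact Hl.
Qed.

Lemma locally_pos (x : R) (P : R -> Prop) :
  0 < x -> (forall y, 0 < y -> P y) -> locally x P.
Proof.
intros Hx H; assert (Hx2 : 0 < x / 2) by lra.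
exists (mkposreal _ Hx2); intros y Hy; apply H.
assert (H1 := half_ball_pos x y Hx Hy); lra.
Qed.

(** [psi] is defined from the derivative of [Gamma], whereas the limit theorem differentiates
    [ln Gamma]; near [x], [Gamma = exp (ln Gamma)] transfers the derivative. *)
Lemma psi_lim (x : R) : 0 < x -> is_lim_seq (fun n => digamma_seq n x) (psi x).
Proof.
intros Hx; destruct (digamma_lim x Hx) as [l Hl].
assert (H := ln_Gamma_derive x l Hx Hl).
assert (HG := Gamma_pos x Hx).
replace (psi x) with l; [exact Hl|].
assert (HD : is_derive Gamma x (l * Gamma x)).
{ apply (is_derive_ext_loc (fun y => exp (ln (Gamma y)))).
  - apply locally_pos; [exact Hx|]; intros y Hy; apply exp_ln; now apply Gamma_pos.
  - rewrite <- (exp_ln (Gamma x)) by exact HG.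
    apply (is_derive_comp exp (fun y => ln (Gamma y))); [apply is_derive_exp|exact H]. }
unfold psi; rewrite (is_derive_unique _ _ _ HD); field; lra.
Qed.

Lemma psi_derive (x : R) : 0 < x -> is_derive psi x (hurwitz 2 x).
Proof.
intros Hx.
apply (is_derive_lim digamma_seq (fun n y => sum_n (hurwitz_term 2 y) n)
  (fun n y => - INR 2 * sum_n (hurwitz_term 3 y) n) _ x (x / 2)
  (INR 2 * hurwitz_bound 1 (x / 2))).
- lra.
- apply Rmult_lt_0_compat; [simpl; lra|apply hurwitz_bound_pos; lra].
- intros n z Hz; apply half_ball_pos in Hz; [|exact Hx].
  unfold digamma_seq.
  replace (sum_n (hurwitz_term 2 z) n)
    with (0 - (- INR 1 * sum_n (hurwitz_term 2 z) n)) by (simpl INR; ring).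
  apply (is_derive_minus (fun _ => ln (INR (S n)))
    (fun y => sum_n (hurwitz_term 1 y) n)).
  + apply (is_derive_const (ln (INR (S n)))).
  + apply hurwitz_partial_derive; lra.
- intros n z Hz; apply half_ball_pos in Hz; [|exact Hx].
  apply hurwitz_partial_derive; lra.
- intros n z Hz; apply half_ball_pos in Hz; [|exact Hx].
  rewrite Rabs_mult, Rabs_Ropp, (Rabs_pos_eq (INR 2)) by apply pos_INR.
  apply Rmult_le_compat_l; [apply pos_INR|].
  apply hurwitz_partial_abs_bound; lra.
- intros z Hz; apply half_ball_pos in Hz; [|exact Hx]; apply psi_lim; lra.
- now apply hurwitz_lim.
Qed.

Lemma polygamma_series (k : nat) (x : R) :
  0 < x ->
  polygamma (S k) x = (-1) ^ k * INR (fact (S k)) * hurwitz (S (S k)) x.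
Proof.
revert x; induction k as [|k IH]; intros x Hx.
- change (polygamma 1 x) with (Derive psi x).
  rewrite (is_derive_unique _ _ _ (psi_derive x Hx)); simpl; ring.
- change (polygamma (S (S k)) x) with (Derive (polygamma (S k)) x).
  rewrite (Derive_ext_loc _ (fun y => (-1) ^ k * INR (fact (S k)) * hurwitz (S (S k)) y)).
  2: { apply locally_pos; [exact Hx|exact IH]. }
  rewrite Derive_scal, (is_derive_unique _ _ _ (hurwitz_derive k x Hx)).
  rewrite (fact_simpl (S k)), mult_INR; simpl pow; ring.
Qed.

Lemma polygamma_abs (k : nat) (x : R) :
  0 < x -> Rabs (polygamma (S k) x) = INR (fact (S k)) * hurwitz (S (S k)) x.
Proof.
intros Hx; rewrite polygamma_series by exact Hx.
rewrite !Rabs_mult, pow_1_abs, Rmult_1_l.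
rewrite !Rabs_pos_eq; [reflexivity| |apply pos_INR].
now apply Rlt_le, hurwitz_pos.
Qed.

(** * The lower bound *)

Lemma MVT_is_derive (f f' : R -> R) (a b : R) :
  a < b -> (forall c, a <= c <= b -> is_derive f c (f' c)) ->
  exists c, f b - f a = f' c * (b - a) /\ a < c < b.
Proof.
intros Hab H; apply MVT_cor2; [exact Hab|].
intros c Hc; now apply is_derive_Reals, H.
Qed.

(* The primitive of [s^j exp (- a s)] that vanishes at 0. *)
Fixpoint exp_moment (j : nat) (a t : R) : R :=
  match j with
  | O => (1 - exp (- (a * t))) / a
  | S i => (INR (S i) * exp_moment i a t - t ^ S i * exp (- (a * t))) / a
  end.

Lemma exp_moment_derive (j : nat) (a t : R) :
  0 < a -> is_derive (exp_moment j a) t (t ^ j * exp (- (a * t))).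
Proof.
intros Ha; revert t; induction j as [|j IH]; intros t.
- simpl; auto_derive; [trivial|field; lra].
- apply (is_derive_ext (fun t => / a *
    (INR (S j) * exp_moment j a t - t ^ S j * exp (- (a * t))))).
  { intros u; change (exp_moment (S j) a u) with
      ((INR (S j) * exp_moment j a u - u ^ S j * exp (- (a * u))) / a).
    unfold Rdiv; apply Rmult_comm. }
  replace (t ^ S j * exp (- (a * t))) with
    (/ a * (INR (S j) * (t ^ j * exp (- (a * t)))
      - (INR (S j) * t ^ j * exp (- (a * t)) + t ^ S j * (- a * exp (- (a * t))))))
    by (field; lra).
  apply (is_derive_scal (fun t =>
    INR (S j) * exp_moment j a t - t ^ S j * exp (- (a * t)))).
  apply (is_derive_minus (fun t => INR (S j) * exp_moment j a t)
    (fun t => t ^ S j * exp (- (a * t)))).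
  + apply (is_derive_scal (exp_moment j a)), IH.
  + auto_derive; [trivial|].
    change (match j with 0%nat => 1 | S _ => INR j + 1 end) with (INR (S j)).
    simpl pow; ring.
Qed.

Lemma exp_moment_0 (j : nat) (a : R) : exp_moment j a 0 = 0.
Proof.
induction j as [|j IH]; simpl.
- rewrite Rmult_0_r, Ropp_0, exp_0; unfold Rdiv; ring.
- rewrite IH; unfold Rdiv; ring.
Qed.

(** With [p = j + 1], [(a t)^p exp (- a t)] is at most [p^p]; the additional factor [t] gives the
    decay. The form [/ t ^ 1] matches [inv_pow_shift_lim]. *)
Lemma pow_exp_decay (j : nat) (a : R) :
  0 < a ->
  exists C, forall t, 0 < t -> 0 <= t ^ j * exp (- (a * t)) <= C * / t ^ 1.
Proof.
intros Ha; set (p := INR (S j)).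
assert (Hp : 0 < p) by (apply lt_0_INR; lia).
exists (exp (p * ln p) * / a ^ S j); intros t Ht.
assert (Hat : 0 < a * t) by now apply Rmult_lt_0_compat.
assert (Htj : 0 < t ^ j) by now apply pow_lt.
assert (Haj : 0 < a ^ S j) by now apply pow_lt.
assert (He := exp_pos (- (a * t))).
split; [apply Rmult_le_pos; lra|].
assert (H : (a * t) ^ S j * exp (- (a * t)) <= exp (p * ln p)).
{ rewrite <- Rpower_pow by exact Hat; unfold Rpower; rewrite <- exp_plus.
  apply Rle_exp; assert (H := ln_mult_le p (a * t) Hp Hat); fold p; lra. }
rewrite Rpow_mult_distr in H.
apply Rmult_le_reg_r with (t * a ^ S j); [now apply Rmult_lt_0_compat|].
replace (exp (p * ln p) * / a ^ S j * / t ^ 1 * (t * a ^ S j))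
  with (exp (p * ln p)) by (rewrite pow_1; field; lra).
replace (t ^ j * exp (- (a * t)) * (t * a ^ S j))
  with (a ^ S j * t ^ S j * exp (- (a * t))) by (simpl; ring).
exact H.
Qed.

Lemma pow_exp_lim (j : nat) (a s : R) :
  0 < a -> 0 < s ->
  is_lim_seq (fun n => (s + INR n) ^ j * exp (- (a * (s + INR n)))) 0.
Proof.
intros Ha Hs; destruct (pow_exp_decay j a Ha) as [C HC].
apply is_lim_seq_le_le with (fun _ => 0) (fun n => C * / (s + INR n) ^ 1).
- intros n; apply HC; assert (H := pos_INR n); lra.
- apply is_lim_seq_const.
- replace 0 with (C * 0) by ring.
  apply (is_lim_seq_mult' (fun _ => C)); [apply is_lim_seq_const|].
  now apply inv_pow_shift_lim.
Qed.

(** The Laplace transform of [t^j], as a limit along the points [s + n], by the recursion that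
    integration by parts gives. *)
Lemma exp_moment_lim (j : nat) (a s : R) :
  0 < a -> 0 < s ->
  is_lim_seq (fun n => exp_moment j a (s + INR n)) (INR (fact j) * / a ^ S j).
Proof.
intros Ha Hs; induction j as [|j IH].
- apply is_lim_seq_ext with
    (fun n => / a * (1 - (s + INR n) ^ 0 * exp (- (a * (s + INR n))))).
  { intros n; simpl; field; lra. }
  replace (INR (fact 0) * / a ^ 1) with (/ a * (1 - 0)) by (simpl; field; lra).
  apply (is_lim_seq_mult' (fun _ => / a)); [apply is_lim_seq_const|].
  apply (is_lim_seq_minus' (fun _ => 1)); [apply is_lim_seq_const|].
  now apply pow_exp_lim.
- apply is_lim_seq_ext with (fun n => / a * (INR (S j) * exp_moment j a (s + INR n)
    - (s + INR n) ^ S j * exp (- (a * (s + INR n))))).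
  { intros n; change (exp_moment (S j) a (s + INR n)) with
      ((INR (S j) * exp_moment j a (s + INR n)
        - (s + INR n) ^ S j * exp (- (a * (s + INR n)))) / a).
    unfold Rdiv; apply Rmult_comm. }
  replace (INR (fact (S j)) * / a ^ S (S j))
    with (/ a * (INR (S j) * (INR (fact j) * / a ^ S j) - 0)).
  2: { rewrite fact_simpl, mult_INR.
       change (a ^ S (S j)) with (a * a ^ S j).
       field; repeat split; try apply pow_nonzero; lra. }
  apply (is_lim_seq_mult' (fun _ => / a)); [apply is_lim_seq_const|].
  apply is_lim_seq_minus'; [|now apply pow_exp_lim].
  apply (is_lim_seq_mult' (fun _ => INR (S j))); [apply is_lim_seq_const|exact IH].
Qed.

Lemma geometric_exp (N : nat) (t : R) :
  (exp t - 1) * sum_n (fun n => exp (- ((1 + INR n) * t))) N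
  = 1 - exp (- (INR (S N) * t)).
Proof.
induction N as [|N IH].
- rewrite sum_O; simpl INR.
  replace (- ((1 + 0) * t)) with (- t) by ring.
  replace (- (1 * t)) with (- t) by ring.
  rewrite Rmult_minus_distr_r, <- exp_plus, Rplus_opp_r, exp_0; ring.
- rewrite sum_Sn_R, Rmult_plus_distr_l, IH, (S_INR (S N)).
  rewrite Rmult_minus_distr_r, <- exp_plus.
  replace (t + - ((1 + INR (S N)) * t)) with (- (INR (S N) * t)) by ring.
  replace (- ((1 + INR (S N)) * t)) with (- ((INR (S N) + 1) * t)) by ring. ring.
Qed.

(* [exp (b t) - exp (- a t) - t] vanishes to second order at 0 and is first
   concave, then convex. *)
Lemma exp_diff_crossing (a b : R) :
  0 < b < a -> a + b = 1 ->
  exists t0, 0 < t0 /\ forall t, 0 < t ->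
    (t < t0 -> exp (b * t) - exp (- (a * t)) <= t) /\
    (t0 < t -> t < exp (b * t) - exp (- (a * t))).
Proof.
intros Hba Hab1.
set (f := fun t => exp (b * t) - exp (- (a * t)) - t).
set (f1 := fun t => b * exp (b * t) + a * exp (- (a * t)) - 1).
set (f2 := fun t => b * b * exp (b * t) - a * a * exp (- (a * t))).
assert (D : forall t, is_derive f t (f1 t)).
{ intros t; unfold f, f1; auto_derive; [trivial|ring]. }
assert (D1 : forall t, is_derive f1 t (f2 t)).
{ intros t; unfold f1, f2; auto_derive; [trivial|ring]. }
(* The zero of [f2]: as [a + b = 1], the equation [f2 t = 0] reads [exp t = (a / b)^2]. *)
set (t1 := ln (a / b) + ln (a / b)).
assert (Hr : 1 < a / b).
{ apply Rmult_lt_reg_r with b; [lra|].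
  unfold Rdiv; rewrite Rmult_assoc, Rinv_l; lra. }
assert (Ht1 : 0 < t1).
{ assert (0 < ln (a / b)) by (rewrite <- ln_1; apply ln_increasing; lra).
  unfold t1; lra. }
assert (Et1 : b * b * exp t1 = a * a).
{ unfold t1; rewrite exp_plus, exp_ln by lra; field; lra. }
assert (F2 : forall t, f2 t = exp (- (a * t)) * (b * b * (exp t - exp t1))).
{ intros t; unfold f2.
  replace (b * t) with (- (a * t) + t) by (replace b with (1 - a) by lra; ring).
  rewrite exp_plus, <- Et1; ring. }
assert (Hneg1 : forall t, 0 < t <= t1 -> f1 t < 0).
{ intros t Ht; destruct (MVT_is_derive f1 f2 0 t ltac:(lra)) as [c [Ec Hc]];
    [intros; apply D1|].
  replace (f1 0) with 0 in Ec.
  2: { unfold f1; rewrite !Rmult_0_r, Ropp_0, exp_0; lra. }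
  rewrite F2 in Ec.
  assert (exp c < exp t1) by (apply exp_increasing; lra).
  assert (0 < exp (- (a * c)) * (b * b * (exp t1 - exp c) * t)).
  { repeat apply Rmult_lt_0_compat; try lra; apply exp_pos. }
  lra. }
assert (Hincr : forall s t, t1 <= s < t -> f1 s < f1 t).
{ intros s t Hst; destruct (MVT_is_derive f1 f2 s t ltac:(lra)) as [c [Ec Hc]];
    [intros; apply D1|].
  rewrite F2 in Ec.
  assert (exp t1 < exp c) by (apply exp_increasing; lra).
  assert (0 < exp (- (a * c)) * (b * b * (exp c - exp t1) * (t - s))).
  { repeat apply Rmult_lt_0_compat; try lra; apply exp_pos. }
  lra. }
assert (Hneg : forall t, 0 < t <= t1 -> f t < 0).
{ intros t Ht; destruct (MVT_is_derive f f1 0 t ltac:(lra)) as [c [Ec Hc]];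
    [intros; apply D|].
  replace (f 0) with 0 in Ec.
  2: { unfold f; rewrite !Rmult_0_r, Ropp_0, exp_0; lra. }
  assert (H := Hneg1 c ltac:(lra)).
  assert (0 < - f1 c * (t - 0)) by (apply Rmult_lt_0_compat; lra). lra. }
(* Chosen so that [(b T / 2)^2 = T]; then [exp (b T) >= (1 + b T / 2)^2] exceeds [1 + T]. *)
set (T := 4 / (b * b)).
assert (Hbb : 0 < b * b) by (apply Rmult_lt_0_compat; lra).
assert (HT0 : 0 < T) by (apply Rdiv_lt_0_compat; lra).
assert (HT : 0 < f T).
{ unfold f.
  assert (H1 : exp (- (a * T)) < 1).
  { rewrite <- exp_0; apply exp_increasing.
    assert (0 < a * T) by (apply Rmult_lt_0_compat; lra). lra. }
  assert (H2 := exp_ineq1_le (b * T / 2)).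
  assert (HbT : 0 < b * T) by (apply Rmult_lt_0_compat; lra).
  assert (H3 : (1 + b * T / 2) * (1 + b * T / 2) <= exp (b * T / 2) * exp (b * T / 2))
    by (apply Rmult_le_compat; lra).
  rewrite <- exp_plus in H3.
  replace (b * T / 2 + b * T / 2) with (b * T) in H3 by field.
  assert (H4 : b * T / 2 * (b * T / 2) = T) by (unfold T; field; lra).
  lra. }
assert (HT1 : t1 < T).
{ apply Rnot_le_lt; intros H; assert (H' := Hneg T (conj HT0 H)); lra. }
destruct (IVT f t1 T) as [t0 [Ht0 E0]].
- intros t; apply derivable_continuous_pt; exists (f1 t).
  apply is_derive_Reals, D.
- exact HT1.
- apply Hneg; lra.
- exact HT.
- assert (Ht10 : t1 < t0).
  { destruct (Req_dec t0 t1) as [E|E]; [|lra].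
    assert (H := Hneg t0 ltac:(lra)); lra. }
  exists t0; split; [lra|]; intros t Ht; split; intros Htt.
  + cut (f t <= 0); [unfold f; lra|].
    destruct (Rle_lt_dec t t1) as [H|H]; [now apply Rlt_le, Hneg|].
    (* Beyond [t1] the slope [f1] increases. If [f] had become positive at [t], it would keep rising
       up to [t0], where it vanishes. In the other case, the rise from [f t1 < 0] to 0 at [t0]
       continues to the right of [t0]. *)
    apply Rnot_lt_le; intros Hp.
    destruct (MVT_is_derive f f1 t1 t H) as [c [Ec Hc]]; [intros; apply D|].
    destruct (MVT_is_derive f f1 t t0 Htt) as [d [Ed Hd]]; [intros; apply D|].
    assert (Hn := Hneg t1 ltac:(lra)).
    assert (Hcd := Hincr c d ltac:(lra)).
    assert (Hfc : 0 < f1 c).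
    { apply Rmult_lt_reg_r with (t - t1); lra. }
    assert (0 < f1 d * (t0 - t)) by (apply Rmult_lt_0_compat; lra). lra.
  + cut (0 < f t); [unfold f; lra|].
    destruct (MVT_is_derive f f1 t1 t0 Ht10) as [c [Ec Hc]]; [intros; apply D|].
    destruct (MVT_is_derive f f1 t0 t Htt) as [d [Ed Hd]]; [intros; apply D|].
    assert (Hn := Hneg t1 ltac:(lra)).
    assert (Hcd := Hincr c d ltac:(lra)).
    assert (Hfc : 0 < f1 c).
    { apply Rmult_lt_reg_r with (t0 - t1); lra. }
    assert (0 < f1 d * (t - t0)) by (apply Rmult_lt_0_compat; lra). lra.
Qed.

Definition bose_gap (a t : R) : R := t / (exp t - 1) - exp (- (a * t)).

(** Multiplication by [exp t - 1] reduces this to [exp_diff_crossing] with [b = 1 - a]; its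
    condition [0 < b < a] is exactly [1/2 < a < 1]. *)
Lemma bose_gap_sign (a : R) :
  / 2 < a < 1 ->
  exists t0, 0 < t0 /\ forall t, 0 < t ->
    (t < t0 -> 0 <= bose_gap a t) /\ (t0 < t -> bose_gap a t < 0).
Proof.
intros Ha; destruct (exp_diff_crossing a (1 - a)) as [t0 [Ht0 H]]; [lra|lra|].
exists t0; split; [exact Ht0|]; intros t Ht; destruct (H t Ht) as [H1 H2].
assert (He : 0 < exp t - 1) by (assert (h := exp_ineq1 t ltac:(lra)); lra).
assert (Hi : 0 < / (exp t - 1)) by now apply Rinv_0_lt_compat.
assert (E : bose_gap a t
  = (t - (exp ((1 - a) * t) - exp (- (a * t)))) * / (exp t - 1)).
{ replace ((1 - a) * t) with (- (a * t) + t) by ring.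
  rewrite exp_plus; unfold bose_gap; field; lra. }
rewrite E; split; intros Htt.
- apply Rmult_le_pos; [specialize (H1 Htt)|]; lra.
- specialize (H2 Htt).
  assert (0 < (exp ((1 - a) * t) - exp (- (a * t)) - t) * / (exp t - 1))
    by (apply Rmult_lt_0_compat; lra). lra.
Qed.

(** The primitive, vanishing at 0, of [t^(q + 1) exp (- y t)] times the first [N + 1] terms of [1 /
    (exp t - 1) = exp (- t) + exp (- 2 t) + ...]. *)
Definition bose_primitive (q N : nat) (y t : R) : R :=
  sum_n (fun n => exp_moment (S q) (y + 1 + INR n) t) N.

Lemma bose_primitive_derive (q N : nat) (y t : R) :
  0 <= y ->
  is_derive (bose_primitive q N y) t
    (t ^ S q * exp (- (y * t)) * sum_n (fun n => exp (- ((1 + INR n) * t))) N).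
Proof.
intros Hy.
rewrite <- (sum_n_mult_l (t ^ S q * exp (- (y * t)))
  (fun n => exp (- ((1 + INR n) * t)))).
apply (is_derive_sum_n (fun n t => exp_moment (S q) (y + 1 + INR n) t)).
intros n _; assert (Hn := pos_INR n).
change mult with Rmult.
rewrite Rmult_assoc, <- exp_plus.
replace (- (y * t) + - ((1 + INR n) * t)) with (- ((y + 1 + INR n) * t)) by ring.
apply exp_moment_derive; lra.
Qed.

Lemma bose_primitive_0 (q N : nat) (y : R) : bose_primitive q N y 0 = 0.
Proof.
unfold bose_primitive; induction N as [|N IH].
- rewrite sum_O; apply exp_moment_0.
- rewrite sum_Sn_R, IH, exp_moment_0; ring.
Qed.

Lemma bose_primitive_lim (q N : nat) (y s : R) :
  0 <= y -> 0 < s ->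
  is_lim_seq (fun n => bose_primitive q N y (s + INR n))
    (INR (fact (S q)) * sum_n (hurwitz_term (S (S q)) (y + 1)) N).
Proof.
intros Hy Hs; unfold bose_primitive; induction N as [|N IH].
- apply is_lim_seq_ext with (fun n => exp_moment (S q) (y + 1 + INR 0) (s + INR n)).
  { intros n; now rewrite sum_O. }
  rewrite sum_O; apply exp_moment_lim; simpl; lra.
- apply is_lim_seq_ext with (fun n =>
    sum_n (fun m => exp_moment (S q) (y + 1 + INR m) (s + INR n)) N
    + exp_moment (S q) (y + 1 + INR (S N)) (s + INR n)).
  { intros n; now rewrite sum_Sn_R. }
  rewrite sum_Sn_R, Rmult_plus_distr_l; apply is_lim_seq_plus'; [exact IH|].
  assert (H := pos_INR (S N)); apply exp_moment_lim; lra.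
Qed.

(* With [k = q + 1], the function [t^q bose_gap a t] has integral 0 over the
   half line and changes sign once, at [t0]; multiplying it by the decreasing
   weight [exp (- y t)] makes the integral positive.  Truncating the geometric
   series at [N] costs at most [q! / (N+1)^(q+1)]. *)
Lemma hurwitz_lower (q : nat) (a y : R) :
  / 2 < a < 1 -> 0 < y -> INR (S q) * hurwitz (S (S q)) 1 = / a ^ S q ->
  / (y + a) ^ S q < INR (S q) * hurwitz (S (S q)) (y + 1).
Proof.
intros Ha Hy HZ; destruct (bose_gap_sign a Ha) as [t0 [Ht0 Hsign]].
set (c := exp (- (y * t0))).
assert (Hc : 0 < c < 1).
{ split; [apply exp_pos|]. unfold c; rewrite <- exp_0; apply exp_increasing.
  assert (0 < y * t0) by (now apply Rmult_lt_0_compat). lra. }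
(* With [c] the weight at [t0] subtracted, both factors change sign at [t0], so [K] is nonnegative.
   By [HZ] the subtracted part has integral 0. *)
set (K := fun t => t ^ q * bose_gap a t * (exp (- (y * t)) - c)).
assert (Hw : forall s t, s < t -> exp (- (y * t)) < exp (- (y * s))).
{ intros s t Hst; apply exp_increasing.
  assert (0 < y * (t - s)) by (apply Rmult_lt_0_compat; lra). lra. }
assert (HKpos : forall t, t0 < t -> 0 < K t).
{ intros t Ht; assert (H1 := proj2 (Hsign t ltac:(lra)) Ht).
  assert (H2 := Hw t0 t Ht); fold c in H2.
  replace (K t) with (t ^ q * (- bose_gap a t) * (c - exp (- (y * t))))
    by (unfold K; ring).
  repeat apply Rmult_lt_0_compat; try lra. apply pow_lt; lra. }
assert (HK0 : forall t, 0 < t -> 0 <= K t).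
{ intros t Ht; destruct (Rtotal_order t t0) as [H|[H|H]].
  - assert (H1 := proj1 (Hsign t Ht) H).
    assert (H2 := Hw t t0 H); fold c in H2.
    repeat apply Rmult_le_pos; try lra. apply pow_le; lra.
  - unfold K; rewrite H; fold c; rewrite Rminus_diag, Rmult_0_r; lra.
  - now apply Rlt_le, HKpos. }
(* The minimum [d] of [K] on this interval of length 1, away from [t0], is the positive gap that
   makes the final inequality strict. *)
destruct (continuity_ab_min K (t0 + 1) (t0 + 2)) as [tm [Hmin Htm]]; [lra| |].
{ intros t Ht; apply continuity_pt_filterlim, (ex_derive_continuous K).
  assert (He := exp_ineq1 t ltac:(lra)).
  unfold K, bose_gap; auto_derive; lra. }
assert (Hd := HKpos tm ltac:(lra)); set (d := K tm) in *.
(* [Phi N] is a primitive of [phi N], which is [K] with the geometric series truncated, plus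
   [t^q exp (- (N + 1) t)]. This last term outweighs the truncation error, so that [K <= phi N]. *)
set (Phi := fun N t => bose_primitive q N y t - c * bose_primitive q N 0 t
  - (exp_moment q (y + a) t - c * exp_moment q a t)
  + exp_moment q (INR (S N)) t).
set (S_ := (fun N t => sum_n (fun n => exp (- ((1 + INR n) * t))) N) : nat -> R -> R).
set (phi := fun N t =>
  t ^ S q * exp (- (y * t)) * S_ N t - c * (t ^ S q * exp (- (0 * t)) * S_ N t)
  - (t ^ q * exp (- ((y + a) * t)) - c * (t ^ q * exp (- (a * t))))
  + t ^ q * exp (- (INR (S N) * t))).
assert (HPhi : forall N t, is_derive (Phi N) t (phi N t)).
{ intros N t.
  assert (HN : 0 < INR (S N)) by (apply lt_0_INR; lia).
  apply (is_derive_plus (fun t => bose_primitive q N y t - c * bose_primitive q N 0 t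
    - (exp_moment q (y + a) t - c * exp_moment q a t)) (exp_moment q (INR (S N)))).
  2: now apply exp_moment_derive.
  apply (is_derive_minus
    (fun t => bose_primitive q N y t - c * bose_primitive q N 0 t)
    (fun t => exp_moment q (y + a) t - c * exp_moment q a t)).
  - apply (is_derive_minus (bose_primitive q N y) (fun t => c * bose_primitive q N 0 t)).
    + apply bose_primitive_derive; lra.
    + apply (is_derive_scal (bose_primitive q N 0)), bose_primitive_derive; lra.
  - apply (is_derive_minus (exp_moment q (y + a)) (fun t => c * exp_moment q a t)).
    + apply exp_moment_derive; lra.
    + apply (is_derive_scal (exp_moment q a)), exp_moment_derive; lra. }
assert (HphiK : forall N t, 0 < t -> K t <= phi N t).
{ intros N t Ht.
  assert (He := exp_ineq1_le t). assert (He' := exp_ineq1 t ltac:(lra)).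
  set (g := t / (exp t - 1)).
  assert (Hg : 0 < g <= 1).
  { split; [apply Rdiv_lt_0_compat; lra|].
    apply Rmult_le_reg_r with (exp t - 1); [lra|].
    unfold g, Rdiv; rewrite Rmult_assoc, Rinv_l by lra; lra. }
  assert (E : phi N t - K t
    = t ^ q * exp (- (INR (S N) * t)) * (1 - g * (exp (- (y * t)) - c))).
  { assert (ES : S_ N t = (1 - exp (- (INR (S N) * t))) / (exp t - 1)).
    { apply Rmult_eq_reg_l with (exp t - 1); [|lra].
      unfold S_; rewrite geometric_exp; field; lra. }
    unfold phi, K, bose_gap; fold g.
    replace (t ^ S q * exp (- (y * t)) * S_ N t) with
      (t ^ q * exp (- (y * t)) * (g * (1 - exp (- (INR (S N) * t)))))
      by (rewrite ES; unfold g; simpl pow; field; lra).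
    replace (t ^ S q * exp (- (0 * t)) * S_ N t) with
      (t ^ q * exp (- (0 * t)) * (g * (1 - exp (- (INR (S N) * t)))))
      by (rewrite ES; unfold g; simpl pow; field; lra).
    replace (- ((y + a) * t)) with (- (y * t) + - (a * t)) by ring.
    rewrite Rmult_0_l, Ropp_0, exp_0, exp_plus; ring. }
  assert (Hy1 : exp (- (y * t)) < 1).
  { rewrite <- exp_0; apply exp_increasing.
    assert (0 < y * t) by (now apply Rmult_lt_0_compat). lra. }
  assert (0 <= phi N t - K t); [|lra].
  rewrite E; apply Rmult_le_pos; [apply Rmult_le_pos|].
  - apply pow_le; lra.
  - apply Rlt_le, exp_pos.
  - nra. }
assert (Hmono : forall N s t, 0 <= s <= t -> Phi N s <= Phi N t).
{ intros N s t [Hs [Hst| ->]]; [|lra].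
  destruct (MVT_is_derive (Phi N) (phi N) s t Hst) as [z [Ez Hz]].
  { intros z Hz; apply HPhi. }
  assert (H1 := HphiK N z ltac:(lra)). assert (H2 := HK0 z ltac:(lra)).
  assert (0 <= phi N z * (t - s)) by (apply Rmult_le_pos; lra). lra. }
(* [Phi N] starts at 0, gains at least [d] between [t0 + 1] and [t0 + 2], and decreases nowhere on
   the half line. *)
assert (Hgap : forall N n, d <= Phi N (t0 + 2 + INR n)).
{ intros N n; assert (Hn := pos_INR n).
  assert (H1 := Hmono N 0 (t0 + 1) ltac:(lra)).
  assert (H2 := Hmono N (t0 + 2) (t0 + 2 + INR n) ltac:(lra)).
  destruct (MVT_is_derive (Phi N) (phi N) (t0 + 1) (t0 + 2)) as [z [Ez Hz]];
    [lra|intros z Hz; apply HPhi|].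
  assert (H3 := HphiK N z ltac:(lra)). assert (H4 := Hmin z ltac:(lra)).
  fold d in H4.
  replace (Phi N 0) with 0 in H1.
  2: { unfold Phi; rewrite !bose_primitive_0, !exp_moment_0; ring. }
  lra. }
set (Q := INR (fact q)).
assert (HQ : 0 < Q) by apply INR_fact_lt_0.
set (Z := fun N y => INR (fact (S q)) * sum_n (hurwitz_term (S (S q)) (y + 1)) N).
(* The limit [t] to infinity, with [N] fixed; the limit in [N] follows and removes the compensating
   term. *)
assert (HN : forall N, d <= Z N y - c * Z N 0
  - (Q * / (y + a) ^ S q - c * (Q * / a ^ S q)) + Q * / INR (S N) ^ S q).
{ intros N; assert (HSN : 0 < INR (S N)) by (apply lt_0_INR; lia).
  assert (L : is_lim_seq (fun n => Phi N (t0 + 2 + INR n)) (Z N y - c * Z N 0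
    - (Q * / (y + a) ^ S q - c * (Q * / a ^ S q)) + Q * / INR (S N) ^ S q)).
  { apply is_lim_seq_plus'; [|apply exp_moment_lim; lra].
    apply is_lim_seq_minus'; apply is_lim_seq_minus'.
    - apply bose_primitive_lim; lra.
    - apply (is_lim_seq_mult' (fun _ => c)); [apply is_lim_seq_const|].
      apply bose_primitive_lim; lra.
    - apply exp_moment_lim; lra.
    - apply (is_lim_seq_mult' (fun _ => c)); [apply is_lim_seq_const|].
      apply exp_moment_lim; lra. }
  exact (is_lim_seq_le _ _ _ _ (Hgap N) (is_lim_seq_const d) L). }
assert (HZlim : forall y, 0 <= y ->
  is_lim_seq (fun N => Z N y) (INR (fact (S q)) * hurwitz (S (S q)) (y + 1))).
{ intros z Hz; apply (is_lim_seq_mult' (fun _ => _)); [apply is_lim_seq_const|].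
  apply hurwitz_lim; lra. }
assert (L : is_lim_seq (fun N => Z N y - c * Z N 0
    - (Q * / (y + a) ^ S q - c * (Q * / a ^ S q)) + Q * / INR (S N) ^ S q)
  (INR (fact (S q)) * hurwitz (S (S q)) (y + 1)
   - c * (INR (fact (S q)) * hurwitz (S (S q)) (0 + 1))
   - (Q * / (y + a) ^ S q - c * (Q * / a ^ S q)) + Q * 0)).
{ apply is_lim_seq_plus'.
  - apply (is_lim_seq_minus' _ (fun _ => _)); [|apply is_lim_seq_const].
    apply is_lim_seq_minus'; [apply HZlim; lra|].
    apply (is_lim_seq_mult' (fun _ => c)); [apply is_lim_seq_const|].
    apply HZlim; lra.
  - apply (is_lim_seq_mult' (fun _ => Q)); [apply is_lim_seq_const|].
    apply is_lim_seq_ext with (fun n => / (1 + INR n) ^ S q).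
    { intros n; now rewrite S_INR, Rplus_comm. }
    apply inv_pow_shift_lim; lra. }
assert (H : d <= INR (fact (S q)) * hurwitz (S (S q)) (y + 1)
   - c * (INR (fact (S q)) * hurwitz (S (S q)) (0 + 1))
   - (Q * / (y + a) ^ S q - c * (Q * / a ^ S q)) + Q * 0)
  by exact (is_lim_seq_le _ _ _ _ HN (is_lim_seq_const d) L).
(* Through [HZ] the two multiples of [c] cancel. *)
rewrite Rplus_0_l, fact_simpl, mult_INR, <- HZ in H; fold Q in H.
apply Rmult_lt_reg_l with Q; [exact HQ|]. lra.
Qed.

(** * Reduction of the double inequalities to the tail sum *)

Lemma hurwitz_split (p m : nat) (x : R) :
  0 < x ->
  hurwitz (S (S p)) x
  = sum_n_m (fun i => / (x + INR i - 1) ^ S (S p)) 1 m + hurwitz (S (S p)) (x + INR m).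
Proof.
intros Hx; induction m as [|m IH].
- rewrite sum_n_m_zero by lia; change zero with 0; simpl INR.
  now rewrite Rplus_0_r, Rplus_0_l.
- assert (Hm := pos_INR m).
  rewrite sum_n_Sm by lia; change plus with Rplus.
  rewrite IH, (hurwitz_rec p (x + INR m)), S_INR by lra.
  replace (x + (INR m + 1) - 1) with (x + INR m) by ring.
  replace (x + (INR m + 1)) with (x + INR m + 1) by ring. ring.
Qed.

Lemma polygamma_head (q m : nat) (x : R) :
  0 < x ->
  Rabs (polygamma (S q) x)
  = INR (fact (S q)) * head_sum (S q) m x
    + INR (fact (S q)) * hurwitz (S (S q)) (x + INR m).
Proof.
intros Hx; rewrite polygamma_abs, (hurwitz_split q m) by exact Hx.
unfold head_sum; replace (S q + 1)%nat with (S (S q)) by lia. ring.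
Qed.

(** Splitting starts at [x + 1] and removes [m - 1] terms, so the second double inequality concerns
    the tail at [y = x], while the first one has [y = x + m - 1]. *)
Lemma polygamma_shifted (q m : nat) (x : R) :
  0 < x -> (1 <= m)%nat ->
  Rabs (polygamma (S q) (x + INR m))
  = INR (fact (S q)) * hurwitz (S (S q)) (x + 1)
    - INR (fact (S q)) * shifted_sum (S q) m x.
Proof.
intros Hx Hm; destruct m as [|m]; [lia|]; assert (H := pos_INR m).
rewrite polygamma_abs, (hurwitz_split q m (x + 1)), S_INR
  by (rewrite ?S_INR; lra).
unfold shifted_sum; replace (S q + 1)%nat with (S (S q)) by lia.
replace (S m - 1)%nat with m by lia.
rewrite (sum_n_m_ext (fun i => / (x + 1 + INR i - 1) ^ S (S q))
  (fun i => / (x + INR i) ^ S (S q))).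
2: { intros i; do 2 f_equal; ring. }
replace (x + 1 + INR m) with (x + (INR m + 1)) by ring. ring.
Qed.

Lemma pow_lt_reg (a b : R) (n : nat) : 0 <= b -> a ^ n < b ^ n -> a < b.
Proof.
intros Hb H; apply Rnot_le_lt; intros Hba.
assert (b ^ n <= a ^ n) by (apply pow_incr; lra). lra.
Qed.

(** The bound [1/2] comes from the midpoint estimate at [x = 1], the bound 1 from the first term of
    the series, equal to 1, and the positivity of the rest. They are what [bose_gap_sign] asks
    for. *)
Lemma lower_shift_spec (q : nat) :
  INR (S q) * hurwitz (S (S q)) 1 = / lower_shift (S q) ^ S q
  /\ / 2 < lower_shift (S q) < 1.
Proof.
set (a := lower_shift (S q)).
assert (Ha : 0 < a) by apply exp_pos.
assert (Hap : 0 < a ^ S q) by now apply pow_lt.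
assert (HZ := hurwitz_pos q 1 ltac:(lra)).
assert (HS : 1 <= INR (S q)) by (rewrite S_INR; assert (h := pos_INR q); lra).
assert (HF := INR_fact_lt_0 q).
assert (E : INR (S q) * hurwitz (S (S q)) 1 = / a ^ S q).
{ assert (Ea : a ^ S q = / (INR (S q) * hurwitz (S (S q)) 1)).
  { rewrite <- Rpower_pow by exact Ha; unfold a, lower_shift.
    rewrite Rpower_mult, Rinv_l, Rpower_1.
    - rewrite polygamma_abs, fact_simpl, mult_INR by lra.
      replace (S q - 1)%nat with q by lia. field; lra.
    - rewrite polygamma_abs, fact_simpl, mult_INR by lra.
      replace (S q - 1)%nat with q by lia.
      apply Rdiv_lt_0_compat; [exact HF|].
      repeat apply Rmult_lt_0_compat; lra.
    - lra. }
  now rewrite Ea, Rinv_inv. }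
split; [exact E|split].
- assert (H := hurwitz_lt_midpoint q 1 ltac:(lra)); rewrite E in H.
  apply (pow_lt_reg _ _ (S q)); [lra|].
  replace (1 - / 2) with (/ 2) in H by lra.
  assert (H2 : 0 < (/ 2) ^ S q) by (apply pow_lt; lra).
  apply Rnot_le_lt; intros Hle; apply Rinv_le_contravar in Hle; lra.
- apply (pow_lt_reg _ _ (S q)); [lra|]; rewrite pow1.
  assert (H1 : 1 < / a ^ S q).
  { rewrite <- E, hurwitz_rec, pow1, Rinv_1 by lra.
    assert (H := hurwitz_pos q (1 + 1) ltac:(lra)).
    apply Rle_lt_trans with (INR (S q) * 1); [lra|].
    apply Rmult_lt_compat_l; lra. }
  apply Rnot_le_lt; intros Hle; apply Rinv_le_contravar in Hle; lra.
Qed.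

Lemma tail_lower (q : nat) (y : R) :
  0 < y ->
  INR (fact q) / (y + lower_shift (S q)) ^ S q
  < INR (fact (S q)) * hurwitz (S (S q)) (y + 1).
Proof.
intros Hy; destruct (lower_shift_spec q) as [E Ha].
assert (H := hurwitz_lower q _ y Ha Hy E).
rewrite fact_simpl, mult_INR, (Rmult_comm (INR (S q))), Rmult_assoc.
apply Rmult_lt_compat_l; [apply INR_fact_lt_0|exact H].
Qed.

Lemma tail_upper (q : nat) (y : R) :
  0 < y ->
  INR (fact (S q)) * hurwitz (S (S q)) (y + 1) < INR (fact q) / (y + / 2) ^ S q.
Proof.
intros Hy; assert (H := hurwitz_lt_midpoint q (y + 1) ltac:(lra)).
replace (y + 1 - / 2) with (y + / 2) in H by lra.
rewrite fact_simpl, mult_INR, (Rmult_comm (INR (S q))), Rmult_assoc.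
apply Rmult_lt_compat_l; [apply INR_fact_lt_0|exact H].
Qed.

(** * Optimality of the two constants *)

(** At [x = a - alpha] the assumed inequality becomes [Z(1) < Z(x + 1)] up to a positive factor,
    against the monotonicity of [hurwitz]. *)
Lemma tail_lower_best (q : nat) (alpha : R) :
  0 <= alpha < lower_shift (S q) ->
  ~ (forall x, 0 < x -> INR (fact q) / (x + alpha) ^ S q
       < INR (fact (S q)) * hurwitz (S (S q)) (x + 1)).
Proof.
intros Ha H; destruct (lower_shift_spec q) as [E _].
set (a := lower_shift (S q)) in *.
specialize (H (a - alpha) ltac:(lra)).
replace (a - alpha + alpha) with a in H by ring.
assert (H1 := hurwitz_decr q 1 (a - alpha + 1) ltac:(lra)).
apply Rmult_le_compat_l with (r := INR (fact (S q))) in H1; [|apply pos_INR].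
unfold Rdiv in H; rewrite <- E in H.
rewrite fact_simpl, mult_INR in H, H1; lra.
Qed.

Lemma bernoulli_le (x : R) (n : nat) : -1 <= x -> 1 + INR n * x <= (1 + x) ^ n.
Proof.
intros Hx; induction n as [|n IH]; [simpl; lra|].
rewrite S_INR; change ((1 + x) ^ S n) with ((1 + x) * (1 + x) ^ n).
apply Rle_trans with ((1 + x) * (1 + INR n * x)).
- assert (H := pos_INR n); assert (0 <= INR n * (x * x)).
  { apply Rmult_le_pos; [exact H|apply Rle_0_sqr]. }
  lra.
- apply Rmult_le_compat_l; lra.
Qed.

(* The trapezoidal bound gives [k Z(x+1) >= (1 + k h / 2) / (x+1)^k] with
   [h = 1 / (x+1)], while Bernoulli bounds [(x+beta)^k] below by
   [(x+1)^k (1 + k (beta - 1) h)]. *)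
Lemma tail_upper_best (q : nat) (beta : R) :
  / 2 < beta ->
  ~ (forall x, 0 < x -> INR (fact (S q)) * hurwitz (S (S q)) (x + 1)
       < INR (fact q) / (x + beta) ^ S q).
Proof.
intros Hb H; set (k := INR (S q)).
assert (Hk : 0 < k) by (apply lt_0_INR; lia).
(* Large enough that [k * h < beta - / 2] with [h = / (x + 1)]; in [E5] the gain [beta - / 2] then
   outweighs the term [k * h * (beta - 1) / 2], which is negative for [beta < 1]. *)
set (x := k / (beta - / 2)).
assert (Hx : 0 < x) by (apply Rdiv_lt_0_compat; lra).
assert (Ex : x * (beta - / 2) = k) by (unfold x; field; lra).
specialize (H x Hx).
assert (HT := hurwitz_ge_trapezoid q (x + 1) ltac:(lra)); fold k in HT.
rewrite fact_simpl, mult_INR, (Rmult_comm (INR (S q))), Rmult_assoc in H.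
apply Rmult_lt_reg_l in H; [|apply INR_fact_lt_0]; fold k in H.
set (X := x + 1) in *; set (P := X ^ S q) in *.
assert (HP : 0 < P) by (apply pow_lt; unfold X; lra).
assert (HB : 0 < (x + beta) ^ S q) by (apply pow_lt; lra).
set (h := / X).
assert (Hh : 0 < h) by (apply Rinv_0_lt_compat; unfold X; lra).
assert (HhX : h * X = 1) by (apply Rinv_l; unfold X; lra).
assert (E1 : / P + k / 2 * / X ^ S (S q) = (1 + k * h / 2) * / P).
{ change (X ^ S (S q)) with (X * P); unfold h; field; unfold X; lra. }
rewrite E1 in HT.
assert (E2 : (x + beta) ^ S q = P * (1 + (beta - 1) * h) ^ S q).
{ unfold P; rewrite <- Rpow_mult_distr; f_equal.
  replace (X * (1 + (beta - 1) * h)) with (X + (beta - 1) * (h * X)) by ring.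
  rewrite HhX; unfold X; ring. }
assert (Hlow : (1 + k * h / 2) * (x + beta) ^ S q < P).
{ apply Rmult_lt_reg_r with (/ P); [now apply Rinv_0_lt_compat|].
  rewrite Rinv_r by lra.
  apply Rle_lt_trans with (k * hurwitz (S (S q)) X * (x + beta) ^ S q).
  - replace ((1 + k * h / 2) * (x + beta) ^ S q * / P)
      with ((1 + k * h / 2) * / P * (x + beta) ^ S q) by ring.
    apply Rmult_le_compat_r; lra.
  - rewrite <- (Rinv_l ((x + beta) ^ S q)) by lra.
    apply Rmult_lt_compat_r; lra. }
assert (Hu : -1 <= (beta - 1) * h).
{ assert (h < 1).
  { unfold h; rewrite <- Rinv_1; apply Rinv_lt_contravar; unfold X; lra. }
  nra. }
assert (HBern := bernoulli_le ((beta - 1) * h) (S q) Hu); fold k in HBern.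
rewrite E2 in Hlow.
assert (H3 : (1 + k * h / 2) * (1 + (beta - 1) * h) ^ S q < 1).
{ apply Rmult_lt_reg_l with P; [exact HP|]. lra. }
assert (H4 : (1 + k * h / 2) * (1 + k * ((beta - 1) * h)) < 1).
{ apply Rle_lt_trans with (2 := H3); apply Rmult_le_compat_l; [|exact HBern].
  assert (0 < k * h) by (now apply Rmult_lt_0_compat). lra. }
assert (Hkh : 0 < k * h) by (now apply Rmult_lt_0_compat).
assert (E5 : (1 + k * h / 2) * (1 + k * ((beta - 1) * h)) - 1
  = k * h * ((beta - / 2) + k * h * (beta - 1) / 2)) by field.
assert (H6 : 0 < (beta - / 2) + k * h * (beta - 1) / 2).
{ assert (Hkh2 : k * h < beta - / 2).
  { rewrite <- Ex; replace (x * (beta - / 2) * h) with ((beta - / 2) * (h * x)) by ring.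
    assert (h * x < 1) by (unfold X in HhX; lra). nra. }
  nra. }
assert (0 < k * h * ((beta - / 2) + k * h * (beta - 1) / 2))
  by (now apply Rmult_lt_0_compat). lra.
Qed.

Theorem corollary2 (k : nat) (hk : (1 <= k)%nat) :
  (forall (x : R) (m : nat), 0 < x -> (1 <= m)%nat ->
     INR (fact k) * head_sum k m x
       + INR (fact (k - 1)) / (x + INR m - 1 + lower_shift k) ^ k
       < Rabs (polygamma k x)
     /\ Rabs (polygamma k x)
       < INR (fact k) * head_sum k m x
         + INR (fact (k - 1)) / (x + INR m - / 2) ^ k)
  /\
  (forall (x : R) (m : nat), 0 < x -> (1 <= m)%nat ->
     INR (fact (k - 1)) / (x + lower_shift k) ^ k
       - INR (fact k) * shifted_sum k m x
       < Rabs (polygamma k (x + INR m))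
     /\ Rabs (polygamma k (x + INR m))
       < INR (fact (k - 1)) / (x + / 2) ^ k
         - INR (fact k) * shifted_sum k m x)
  /\
  (forall alpha : R, 0 <= alpha -> alpha < lower_shift k ->
     ~ (forall (x : R) (m : nat), 0 < x -> (1 <= m)%nat ->
          INR (fact k) * head_sum k m x
            + INR (fact (k - 1)) / (x + INR m - 1 + alpha) ^ k
            < Rabs (polygamma k x))
     /\
     ~ (forall (x : R) (m : nat), 0 < x -> (1 <= m)%nat ->
          INR (fact (k - 1)) / (x + alpha) ^ k
            - INR (fact k) * shifted_sum k m x
            < Rabs (polygamma k (x + INR m))))
  /\
  (forall beta : R, / 2 < beta ->
     ~ (forall (x : R) (m : nat), 0 < x -> (1 <= m)%nat ->
          Rabs (polygamma k x)
            < INR (fact k) * head_sum k m x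
              + INR (fact (k - 1)) / (x + INR m - 1 + beta) ^ k)
     /\
     ~ (forall (x : R) (m : nat), 0 < x -> (1 <= m)%nat ->
          Rabs (polygamma k (x + INR m))
            < INR (fact (k - 1)) / (x + beta) ^ k
              - INR (fact k) * shifted_sum k m x)).
Proof.
destruct k as [|q]; [lia|].
replace (S q - 1)%nat with q by lia.
repeat split.
- rewrite (polygamma_head q m x) by assumption.
  assert (Hm : 1 <= INR m) by (apply (le_INR 1); assumption).
  assert (HL := tail_lower q (x + INR m - 1) ltac:(lra)).
  replace (x + INR m - 1 + 1) with (x + INR m) in HL by ring. lra.
- rewrite (polygamma_head q m x) by assumption.
  assert (Hm : 1 <= INR m) by (apply (le_INR 1); assumption).
  assert (HU := tail_upper q (x + INR m - 1) ltac:(lra)).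
  replace (x + INR m - 1 + 1) with (x + INR m) in HU by ring.
  replace (x + INR m - 1 + / 2) with (x + INR m - / 2) in HU by lra. lra.
- rewrite polygamma_shifted by assumption.
  assert (HL := tail_lower q x ltac:(assumption)). lra.
- rewrite polygamma_shifted by assumption.
  assert (HU := tail_upper q x ltac:(assumption)). lra.
(* In all four optimality claims [m = 1] suffices: the finite sums on the two sides cancel and the
   tail inequality at [x] remains. *)
- intros Hall; apply (tail_lower_best q alpha); [lra|].
  intros x Hx; specialize (Hall x 1%nat Hx (le_n 1)).
  rewrite (polygamma_head q 1 x Hx) in Hall; change (INR 1) with 1 in Hall.
  replace (x + 1 - 1 + alpha) with (x + alpha) in Hall by ring. lra.
- intros Hall; apply (tail_lower_best q alpha); [lra|].
  intros x Hx; specialize (Hall x 1%nat Hx (le_n 1)).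
  rewrite polygamma_shifted in Hall by (assumption || lia). lra.
- intros Hall; apply (tail_upper_best q beta); [lra|].
  intros x Hx; specialize (Hall x 1%nat Hx (le_n 1)).
  rewrite (polygamma_head q 1 x Hx) in Hall; change (INR 1) with 1 in Hall.
  replace (x + 1 - 1 + beta) with (x + beta) in Hall by ring. lra.
- intros Hall; apply (tail_upper_best q beta); [lra|].
  intros x Hx; specialize (Hall x 1%nat Hx (le_n 1)).
  rewrite polygamma_shifted in Hall by (assumption || lia). lra.
Qed.
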